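(* For any $\Phi\in\mathrm{Diff}^1(\mathbb{C}^2,0)$, any $N_0\in\mathbb{N}$ and any $\epsilon>0$, there exists $\widehat{\Phi}\in\mathrm{Diff}^1(\mathbb{C}^2,0)$ such that: 1. $J^{N_0}\Phi=J^{N_0}\widehat{\Phi}$; 2. $\Vert\Phi-\widehat{\Phi}\Vert<\epsilon$; 3. $V_{\widehat{\Phi}}$ does not have any formal foliation.
   Context: $\mathrm{Diff}^1(\mathbb{C}^2,0)$ is the set of germs of biholomorphisms of $(\mathbb{C}^2,0)$ tangent to the identity, i.e. pairs $(\phi,\psi)=\left(x+\sum_{i+j>1}a_{ij}x^iy^j,\ y+\sum_{i+j>1}b_{ij}x^iy^j\right)\in\mathbb{C}\{x,y\}^2$ of convergent power series. For a power series, $J^{N}\sum_{i,j\ge0}a_{ij}x^iy^j=\sum_{i+j\le N}a_{ij}x^iy^j$, and $J^N(\phi,\psi)=(J^N\phi,J^N\psi)$. The norm is $\Vert\sum_{i,j\ge0}a_{ij}x^iy^j\Vert=\sup_{i,j}|a_{ij}|\in[0,+\infty]$, and for a pair of series it is the maximum of the norms of the two components. The neighborhood $V_\Phi$: in $S_0=\mathbb{P}^1\times\mathbb{P}^1$, a compactification of $\mathbb{C}^2$ with coordinates $(x,y)$, let $D_1$ be the closure of $\{y=0\}$ and $D_2$ the closure of $\{x=0\}$. Let $(V_i,D_i)$ be a copy of the germ of neighborhood $(S_0,D_i)$, $i=1,2$, and $p_i\in D_i$ the point $(x,y)=(0,0)$. For $\Phi\in\mathrm{Diff}^1(\mathbb{C}^2,0)$,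 $V_\Phi$ (or $(V_\Phi,D)$, $D=D_1\cup D_2$) is the germ of neighborhood obtained by gluing $(V_2,D_2)$ to $(V_1,D_1)$ through $\Phi:(V_2,p_2)\to(V_1,p_1)$. A formal foliation on $V_\Phi$ is defined by $\ker(\omega_1)$, $\ker(\omega_2)$ for two nonzero formal $1$-forms $\omega_i=P_i(x,y)\,dx+Q_i(x,y)\,dy$, $i=1,2$, with $P_1,Q_1\in\mathbb{C}[[y]][x]$ (polynomial in $x$, formal in $y$) and $P_2,Q_2\in\mathbb{C}[[x]][y]$ (polynomial in $y$, formal in $x$), satisfying the compatibility condition $\Phi^*\omega_1\wedge\omega_2=0$ (as formal $2$-forms in $x,y$). *)

(* Defs.v *)
From HB Require Import structures.
From mathcomp Require Import all_boot all_order all_algebra.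
From mathcomp Require Import all_classical all_reals all_analysis.
From mathcomp Require Import complex.

Set Implicit Arguments.
Unset Strict Implicit.
Unset Printing Implicit Defensive.

Import Order.TTheory GRing.Theory Num.Theory.

Local Open Scope classical_set_scope.
Local Open Scope ring_scope.

(* C[[x,y]]: [F i j] is the coefficient of x^i y^j. The additive structure is
   the pointwise one; the product is [fps2_mul], not the pointwise product. *)
Definition fps2 (R : realType) : Type := nat -> nat -> R[i].

HB.instance Definition _ (R : realType) :=
  GRing.Zmodule.copy (fps2 R) (nat -> nat -> R[i]).

Section FormalSeries.
Variable R : realType.
Implicit Types (F G : fps2 R) (Phi w : fps2 R * fps2 R).

Definition fps2_one : fps2 R := fun i j => ((i == 0%N) && (j == 0%N))%:R.
Definition fps2_x : fps2 R := fun i j => ((i == 1%N) && (j == 0%N))%:R.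
Definition fps2_y : fps2 R := fun i j => ((i == 0%N) && (j == 1%N))%:R.

Definition fps2_mul F G : fps2 R := fun k l =>
  \sum_(i < k.+1) \sum_(j < l.+1) F i j * G (k - i)%N (l - j)%N.

Definition fps2_exp F (n : nat) : fps2 R := iter n (fps2_mul F) fps2_one.

Definition fps2_dx F : fps2 R := fun i j => F i.+1 j *+ i.+1.
Definition fps2_dy F : fps2 R := fun i j => F i j.+1 *+ j.+1.

(* F(phi, psi) = sum_(i,j) F_ij phi^i psi^j. This is meaningful only when phi
   and psi have no constant term: phi^i psi^j then has order at least i + j, so
   that the terms with i > k + l or j > k + l do not contribute to the
   coefficient of x^k y^l. *)
Definition fps2_comp F Phi : fps2 R := fun k l =>
  \sum_(i < (k + l).+1) \sum_(j < (k + l).+1)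
     F i j * fps2_mul (fps2_exp Phi.1 i) (fps2_exp Phi.2 j) k l.

Definition jet (N : nat) F : fps2 R :=
  fun i j => if (i + j <= N)%N then F i j else 0.

Definition jet_pair (N : nat) Phi : fps2 R * fps2 R :=
  (jet N Phi.1, jet N Phi.2).

Definition fps2_norm F : \bar R :=
  ereal_sup [set (Normc.normc (F ij.1 ij.2))%:E | ij in [set: nat * nat]].

Definition pair_norm Phi : \bar R :=
  Order.max (fps2_norm Phi.1) (fps2_norm Phi.2).

(* C{x,y}: absolute convergence on some polydisc centred at the origin. *)
Definition fps2_convergent F : Prop :=
  exists2 r : R, 0 < r & forall x y : R[i],
    Normc.normc x < r -> Normc.normc y < r ->
    summable [set: nat * nat]
      (fun ij => (Normc.normc (F ij.1 ij.2 * x ^+ ij.1 * y ^+ ij.2))%:E).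

(* Diff^1(C^2,0) *)
Definition Diff1 : set (fps2 R * fps2 R) := [set Phi |
  [/\ fps2_convergent Phi.1, fps2_convergent Phi.2 &
      jet_pair 1 Phi = (fps2_x, fps2_y)]].

(* The pair w = (P, Q) stands for the formal 1-form P dx + Q dy. *)

(* Phi^*(P dx + Q dy) = P(phi, psi) d(phi) + Q(phi, psi) d(psi) *)
Definition pullback Phi w : fps2 R * fps2 R :=
  let P := fps2_comp w.1 Phi in
  let Q := fps2_comp w.2 Phi in
  (fps2_mul P (fps2_dx Phi.1) + fps2_mul Q (fps2_dx Phi.2),
   fps2_mul P (fps2_dy Phi.1) + fps2_mul Q (fps2_dy Phi.2)).

(* the coefficient of dx /\ dy *)
Definition wedge w1 w2 : fps2 R :=
  fps2_mul w1.1 w2.2 - fps2_mul w1.2 w2.1.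

(* C[[y]][x] *)
Definition polynomial_in_x F : Prop :=
  exists n : nat, forall i j : nat, (n <= i)%N -> F i j = 0.

(* C[[x]][y] *)
Definition polynomial_in_y F : Prop :=
  exists n : nat, forall i j : nat, (n <= j)%N -> F i j = 0.

(* A pair (w1, w2) defining a formal foliation on the neighborhood V_Phi,
   where w1 lives on (V_1, D_1), w2 on (V_2, D_2), and the charts are glued
   through Phi : (V_2, p_2) -> (V_1, p_1). *)
Definition formal_foliation Phi (w1 w2 : fps2 R * fps2 R) : Prop :=
  [/\ w1 <> 0 /\ w2 <> 0,
      polynomial_in_x w1.1 /\ polynomial_in_x w1.2,
      polynomial_in_y w2.1 /\ polynomial_in_y w2.2 &
      wedge (pullback Phi w1) w2 = 0].

Definition has_formal_foliation Phi : Prop :=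
  exists w1 w2 : fps2 R * fps2 R, formal_foliation Phi w1 w2.

End FormalSeries.

(* Main.v *)
From HB Require Import structures.
Require Import Defs.
From mathcomp Require Import all_boot all_order all_algebra.
From mathcomp Require Import all_classical all_reals all_analysis.
From mathcomp Require Import complex.
From mathcomp Require Import zify ring lra.

Set Implicit Arguments.
Unset Strict Implicit.
Unset Printing Implicit Defensive.

Import Order.TTheory GRing.Theory Num.Theory.

Local Open Scope classical_set_scope.
Local Open Scope ring_scope.

(** A foliation is given by polynomials in one variable with power series
coefficients in the other, so its jet of order N depends on O(N) numbers,
whereas the jet of order N of a component of Phi consists of about N^2/2
numbers.  The proof turns this into a comparison of transcendence degrees.

A series is called slowly generated over a set S of numbers when its
coefficients of degree at most N lie in a field generated by S and O(N) further
numbers.  The coefficients of the two forms have this property.  The key point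
is that it propagates through the foliation equation
(slowly_generated_transfer): if phi and the forms are slowly generated and
Phi^* w1 /\ w2 = 0 with Q1 <> 0, then psi is slowly generated too.  Indeed,
cutting off psi at a monomial x^p y^q changes the equation, to first order, by
an affine function of (p, q) times the coefficient psi_pq; off the line where
this function vanishes, psi_pq is therefore a rational function of the forms,
of phi and of the earlier coefficients of psi (resonance).  The exceptional
coefficients lie on a line, hence there are only O(N) of them.

On the other hand, a series whose high-order coefficients are algebraically
independent over S is not slowly generated (generic_not_slowly_generated): this
is the comparison of N^2 with O(N), by the invariance of the transcendence
degree (transcendental_chain_size).  Such a series exists as close as desired to
any given series when S is countable, because the numbers algebraic over a
countable field form a countable set (generic_perturbation).

So phi is perturbed generically over the prime field, and psi generically over
the coefficients of phi.  A foliation with Q1 <> 0 would make psi slowly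
generated over the coefficients of phi.  If Q1 = 0, the equation reduces to
d(phi) /\ w2 = 0, in which psi does not occur, and the same transfer principle
would make phi slowly generated over the prime field. *)

(** * Fields generated by a set of numbers *)

Inductive fieldgen (F : fieldType) (S : set F) : F -> Prop :=
| fieldgen_in x of S x : fieldgen S x
| fieldgen1 : fieldgen S 1
| fieldgenD x y of fieldgen S x & fieldgen S y : fieldgen S (x + y)
| fieldgenN x of fieldgen S x : fieldgen S (- x)
| fieldgenM x y of fieldgen S x & fieldgen S y : fieldgen S (x * y)
| fieldgenV x of fieldgen S x : fieldgen S x^-1.

Section FieldGen.
Variable F : fieldType.
Implicit Types (S T : set F) (x y : F).

Lemma fieldgen0 S : fieldgen S 0.
Proof. by rewrite -(subrr 1); apply/fieldgenD/fieldgenN; apply: fieldgen1. Qed.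

Lemma fieldgenB S x y : fieldgen S x -> fieldgen S y -> fieldgen S (x - y).
Proof. by move=> Sx Sy; apply/fieldgenD/fieldgenN. Qed.

Lemma fieldgenX S x n : fieldgen S x -> fieldgen S (x ^+ n).
Proof.
move=> Sx; elim: n => [|n IHn]; first by rewrite expr0; apply: fieldgen1.
by rewrite exprS; apply: fieldgenM.
Qed.

Lemma fieldgen_sum S (I : Type) (r : seq I) (P : pred I) (f : I -> F) :
  (forall i, P i -> fieldgen S (f i)) -> fieldgen S (\sum_(i <- r | P i) f i).
Proof.
by move=> Sf; apply: big_ind => // [|x y]; [exact: fieldgen0 | exact: fieldgenD].
Qed.

Lemma fieldgen_prod S (I : Type) (r : seq I) (P : pred I) (f : I -> F) :
  (forall i, P i -> fieldgen S (f i)) -> fieldgen S (\prod_(i <- r | P i) f i).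
Proof. by move=> Sf; apply: big_ind => // [|x y]; [exact: fieldgen1 | exact: fieldgenM]. Qed.

Lemma fieldgen_nat S n : fieldgen S n%:R.
Proof.
elim: n => [|n IHn]; first exact: fieldgen0.
by rewrite -natr1; apply: fieldgenD => //; apply: fieldgen1.
Qed.

Lemma fieldgenMn S x n : fieldgen S x -> fieldgen S (x *+ n).
Proof. by move=> Sx; rewrite -mulr_natr; apply: fieldgenM => //; apply: fieldgen_nat. Qed.

Lemma fieldgen_sub S T : S `<=` fieldgen T -> fieldgen S `<=` fieldgen T.
Proof.
move=> ST x; elim=> {x} [x /ST//||x y _ Tx _ Ty|x _ Tx|x y _ Tx _ Ty|x _ Tx].
- exact: fieldgen1.
- exact: fieldgenD.
- exact: fieldgenN.
- exact: fieldgenM.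
- exact: fieldgenV.
Qed.

Lemma fieldgenS S T : S `<=` T -> fieldgen S `<=` fieldgen T.
Proof. by move=> ST; apply: fieldgen_sub => x /ST; apply: fieldgen_in. Qed.

(** Elimination of the last column: all entries stay in the field, so that the
dependence relation has coefficients there too. *)
Lemma fieldgen_dependence S (m n : nat) (A : 'I_n -> 'I_m -> F) : (m < n)%N ->
    (forall i j, fieldgen S (A i j)) ->
  exists c : 'I_n -> F, [/\ forall i, fieldgen S (c i), exists i, c i != 0
     & forall j, \sum_i c i * A i j = 0].
Proof.
elim: m n A => [|m IHm] [//|n] A ltmn SA.
  exists (fun=> 1); split; [by move=> *; apply: fieldgen1 | by exists ord0; rewrite oner_neq0|].
  by case.
case: (pselect (exists i, A i ord_max != 0)) => [[i0 piv]|A0]; last first.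
  have [|//|c [Sc c0 cA]] := IHm n.+1 (fun i j => A i (widen_ord (leqnSn m) j)).
    by rewrite ltnW.
  exists c; split=> // j; have [ltjm|lejm] := ltnP j m.
    rewrite -[RHS](cA (Ordinal ltjm)); apply: eq_bigr => i _; congr (_ * A i _).
    exact: val_inj.
  have -> : j = ord_max by apply: val_inj => /=; have := ltn_ord j; lia.
  rewrite big1 // => i _; have [->|nz] := eqVneq (A i ord_max) 0; first by rewrite mulr0.
  by case: A0; exists i.
pose e i := A (lift i0 i) ord_max / A i0 ord_max.
pose w (j : 'I_m) := widen_ord (leqnSn m) j.
have Se i : fieldgen S (e i) by apply/fieldgenM/fieldgenV.
have [||c [Sc [i1 c0] cA]] := IHm n (fun i j => A (lift i0 i) (w j) - e i * A i0 (w j)) => //.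
  by move=> i j; apply: fieldgenB => //; apply: fieldgenM.
pose f i := if unlift i0 i is Some k then c k else - \sum_k c k * e k.
have f_lift k : f (lift i0 k) = c k by rewrite /f liftK.
have f_i0 : f i0 = - \sum_k c k * e k by rewrite /f unlift_none.
exists f; split.
- move=> i; rewrite /f; case: unliftP => [k _|_] //; apply: fieldgenN.
  by apply: fieldgen_sum => k _; apply: fieldgenM.
- by exists (lift i0 i1); rewrite f_lift.
move=> j; rewrite (bigD1_ord i0) //= f_i0.
under eq_bigr do rewrite f_lift.
rewrite mulNr mulr_suml addrC; apply/eqP; rewrite subr_eq0; apply/eqP.
have [ltjm|lejm] := ltnP j m.
  have := cA (Ordinal ltjm); have -> : w (Ordinal ltjm) = j by exact: val_inj.
  move=> /eqP/=; under eq_bigr do rewrite mulrBr mulrA.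
  by rewrite sumrB subr_eq0 => /eqP.
have -> : j = ord_max by apply: val_inj => /=; have := ltn_ord j; lia.
by apply: eq_bigr => k _; rewrite -mulrA /e divfK.
Qed.

End FieldGen.

(** * Invariance of the transcendence degree *)

Section Counting.
Variable F : fieldType.
Implicit Types (S : set F) (x y : F) (l s : seq F).

Definition monom l (e : seq nat) : F := \prod_(i < size l) l`_i ^+ nth 0%N e i.

Lemma monom_cons x l k e : monom (x :: l) (k :: e) = x ^+ k * monom l e.
Proof. by rewrite /monom big_ord_recl. Qed.

(** The values at [l] of polynomials of degree at most [d] in each variable; the
degree is only an upper bound, which makes sums and products immediate. *)
Inductive poly_in S l : nat -> F -> Prop :=
| poly_in_cst x of fieldgen S x : poly_in S l 0 x
| poly_in_var x of x \in l : poly_in S l 1 x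
| poly_inD d x y of poly_in S l d x & poly_in S l d y : poly_in S l d (x + y)
| poly_inM d e x y of poly_in S l d x & poly_in S l e y :
    poly_in S l (d + e) (x * y)
| poly_inW d e x of (d <= e)%N & poly_in S l d x : poly_in S l e x.

Inductive span S (B : set F) : F -> Prop :=
| span0 : span S B 0
| span_cons c b x of fieldgen S c & B b & span S B x : span S B (c * b + x).

Lemma spanD S B x y : span S B x -> span S B y -> span S B (x + y).
Proof.
move=> Bx By; elim: Bx => [|c b z Sc Bb _ IH]; first by rewrite add0r.
by rewrite -addrA; apply: span_cons.
Qed.

(** Stability of the spans of monomials under products reduces to the stability
of the monomials themselves. *)
Lemma spanM S (B1 B2 B3 : set F) x y :
    (forall u v, B1 u -> B2 v -> B3 (u * v)) ->
  span S B1 x -> span S B2 y -> span S B3 (x * y).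
Proof.
move=> B123 B1x B2y; elim: B1x => [|c b z Sc Bb _ IH].
  by rewrite mul0r; apply: span0.
rewrite mulrDl; apply: spanD => //.
elim: B2y => [|c' b' z' Sc' Bb' _ IH']; first by rewrite mulr0; apply: span0.
rewrite mulrDr mulrACA; apply: span_cons => //; first exact: fieldgenM.
exact: B123.
Qed.

Lemma spanS S (B1 B2 : set F) : B1 `<=` B2 -> span S B1 `<=` span S B2.
Proof.
move=> B12 x; elim=> [|c b z Sc Bb _ IH]; first exact: span0.
by apply: span_cons => //; apply: B12.
Qed.

Lemma span_coord S (I : finType) (m : I -> F) x : span S (range m) x ->
  exists2 c : I -> F, forall i, fieldgen S (c i) & x = \sum_i c i * m i.
Proof.
elim=> [|c b z Sc [i _ <-] _ [c' Sc' ->]].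
  by exists (fun=> 0) => [i|]; [exact: fieldgen0 | rewrite big1 // => i _; rewrite mul0r].
exists (fun j => c' j + c *+ (j == i)) => [j|].
  by apply: fieldgenD => //; apply: fieldgenMn.
rewrite addrC; under [RHS]eq_bigr do rewrite mulrDl.
rewrite big_split/=; congr (_ + _).
rewrite (bigD1 i)//= eqxx mulr1n big1 ?addr0// => j /negPf ->.
by rewrite mulr0n mul0r.
Qed.

Definition monom_bounded l d : set F :=
  [set monom l e | e in [set e | forall i, (nth 0 e i <= d)%N]].

Lemma monom0 l : monom l [::] = 1.
Proof. by rewrite /monom big1 // => i _; rewrite nth_nil expr0. Qed.

Lemma poly_in_span S l d x : poly_in S l d x -> span S (monom_bounded l d) x.
Proof.
elim=> {d x} [x Sx|x lx|d x y _ IHx _|d e x y _ IHx _ IHy|d e x ltde _].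
- rewrite -[x]addr0 -[x]mulr1; apply: span_cons => //; last exact: span0.
  by exists [::]; [move=> i; rewrite nth_nil | rewrite monom0].
- rewrite -[x]addr0 -[x]mul1r; apply: span_cons => //; last exact: span0.
    exact: fieldgen1.
  exists (nseq (index x l) 0 ++ [:: 1])%N.
    move=> i /=; rewrite nth_cat nth_nseq size_nseq; do 2?case: ifP => // _.
    by case: (i - _)%N => [|k] //=; rewrite nth_nil.
  rewrite -index_mem in lx; rewrite /monom (bigD1 (Ordinal lx))//=.
  rewrite nth_cat size_nseq ltnn subnn expr1 nth_index -?index_mem//.
  rewrite big1 ?mulr1// => i; rewrite -val_eqE/= => nei.
  rewrite nth_cat nth_nseq size_nseq; case: ltnP => // lei.
  have : (0 < i - index x l)%N by lia.
  by case: (i - _)%N => [|k] //= _; rewrite nth_nil expr0.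
- exact: spanD.
- apply: spanM IHx IHy => _ _ [e1 /= e1d <-] [e2 /= e2d <-].
  exists [seq nth 0 e1 i + nth 0 e2 i | i <- iota 0 (size l)]%N.
    move=> i /=; have [ltil|leli] := ltnP i (size l).
      by rewrite (nth_map 0%N) ?size_iota// nth_iota// leq_add.
    by rewrite nth_default// size_map size_iota.
  rewrite /monom -big_split/=; apply: eq_bigr => i _.
  by rewrite (nth_map 0%N) ?size_iota// nth_iota// add0n exprD.
- apply: spanS => _ [e1 /= e1d <-]; exists e1 => // i; exact: leq_trans (e1d i) _.
Qed.

Lemma poly_in_coord S l d x : poly_in S l d x ->
  exists2 c : (size l).-tuple 'I_d.+1 -> F, forall e, fieldgen S (c e) &
    x = \sum_e c e * monom l (map val e).
Proof.
move=> /poly_in_span Bx; apply: span_coord; apply: spanS Bx => _ [e/= ed <-].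
exists [tuple inord (nth 0%N e i) | i < size l] => //.
apply: eq_bigr => i _; rewrite (nth_map (inord 0)) ?size_tuple// -tnth_nth.
by rewrite tnth_mktuple /= inordK// ltnS.
Qed.

Lemma poly_in1 S l : poly_in S l 0 1.
Proof. exact/poly_in_cst/fieldgen1. Qed.

Lemma poly_inX S l d x n : poly_in S l d x -> poly_in S l (d * n) (x ^+ n).
Proof.
move=> dx; elim: n => [|n IHn]; first by rewrite muln0; apply: poly_in1.
by rewrite mulnS exprS; apply: poly_inM.
Qed.

Lemma poly_in_prod S l (I : finType) (P : pred I) (d : nat) (f : I -> F) :
    (forall i, P i -> poly_in S l d (f i)) ->
  poly_in S l (#|I| * d) (\prod_(i | P i) f i).
Proof.
move=> fd.
have : poly_in S l (\sum_(i | P i) d) (\prod_(i | P i) f i).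
  apply: (big_rec2 (fun n x => poly_in S l n x)); first exact: poly_in1.
  by move=> i n x Pi nx; apply: poly_inM => //; apply: fd.
apply: poly_inW; rewrite sum_nat_const leq_mul2r; apply/orP; right; exact: max_card.
Qed.

Lemma fieldgen_frac S l x : fieldgen (S `|` [set` l]) x ->
  exists d p q, [/\ poly_in S l d p, poly_in S l d q, q != 0 & x * q = p].
Proof.
elim=> {x} [x Sx||x y _ [d [p [q [dp dq q0 xq]]]] _ [d' [p' [q' [dp' dq' q'0 xq']]]]
  |x _ [d [p [q [dp dq q0 xq]]]]|x y _ [d [p [q [dp dq q0 xq]]]] _ [d' [p' [q' [dp' dq' q'0 xq']]]]
  |x _ [d [p [q [dp dq q0 xq]]]]].
- case: Sx => [Sx|lx].
    exists 0%N, x, 1; split; rewrite ?oner_neq0 ?mulr1//; last exact: poly_in1.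
    exact/poly_in_cst/fieldgen_in.
  exists 1%N, x, 1; split; rewrite ?oner_neq0 ?mulr1//.
    exact: poly_in_var.
  by apply: poly_inW (poly_in1 _ _).
- by exists 0%N, 1, 1; split; rewrite ?oner_neq0 ?mulr1//; apply: poly_in1.
- exists (d + d')%N, (p * q' + q * p'), (q * q'); split.
  + by apply: poly_inD; apply: poly_inM.
  + exact: poly_inM.
  + by rewrite mulf_neq0.
  + by rewrite -xq -xq'; ring.
- exists d, (- p), q; split => //; last by rewrite mulNr xq.
  rewrite -mulN1r; apply: (@poly_inM S l 0) => //.
  by apply/poly_in_cst/fieldgenN/fieldgen1.
- exists (d + d')%N, (p * p'), (q * q'); split.
  + exact: poly_inM.
  + exact: poly_inM.
  + by rewrite mulf_neq0.
  + by rewrite -xq -xq'; ring.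
have [->|x0] := eqVneq x 0.
  by exists d, 0, q; split; rewrite ?invr0 ?mul0r //; apply: poly_inW (leq0n _) _;
    apply: poly_in_cst; apply: fieldgen0.
exists d, q, p; split=> //; first by rewrite -xq mulf_neq0.
by rewrite -xq mulKf.
Qed.

(** Finitely many fractions share a denominator, so that the monomials of bounded
degree in the [t i] become, after multiplication by one power of it, polynomials
of bounded degree in [l]. *)
Lemma fieldgen_common_denominator S l n (t : 'I_n -> F) :
    (forall i, fieldgen (S `|` [set` l]) (t i)) ->
  exists d q, [/\ poly_in S l d q, q != 0 & forall i, poly_in S l d (t i * q)].
Proof.
move=> /(fun h i => fieldgen_frac (h i)) => h.
have {h} [d [q h]] : exists d q, forall i, [/\ poly_in S l d (q i),
    q i != 0 & poly_in S l d (t i * q i)].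
  elim: n t h => [|n IHn] t h.
    by exists 0%N, (fun=> 0) => -[].
  have [d [q hq]] := IHn (fun i => t (lift ord0 i)) (fun i => h _).
  have [d' [p' [q' [dp dq q0 tq]]]] := h ord0.
  exists (maxn d d'), (fun i => if unlift ord0 i is Some k then q k else q').
  move=> i; case: unliftP => [k|] ->.
    have [? ? ?] := hq k; split=> //; apply: (@poly_inW _ _ d) => //; lia.
  split=> //; first by apply: (@poly_inW _ _ d') => //; lia.
  by rewrite tq; apply: (@poly_inW _ _ d') => //; lia.
exists (n * d)%N, (\prod_i q i); split.
- rewrite -{1}(card_ord n); apply: poly_in_prod => i _; by have [] := h i.
- by rewrite prodf_seq_neq0; apply/allP => i _; have [] := h i.
- move=> i; have -> : t i * \prod_j q j = \prod_j (if j == i then t j * q j else q j).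
    rewrite (bigD1 i)//= [RHS](bigD1 i)//= eqxx mulrA; congr (_ * _).
    by apply: eq_bigr => j /negPf ->.
  rewrite -{1}(card_ord n); apply: poly_in_prod => j _.
  by have [? _ ?] := h j; case: ifP.
Qed.

Definition transcendental_over S x :=
  forall n (c : 'I_n -> F), (forall i, fieldgen S (c i)) ->
    \sum_i c i * x ^+ i = 0 -> forall i, c i = 0.

(** Algebraic independence over [fieldgen S], in the one-element-at-a-time form
in which it is produced: each element is transcendental over those that follow. *)
Fixpoint transcendental_chain S s : Prop :=
  if s is x :: s' then
    transcendental_over (S `|` [set` s']) x /\ transcendental_chain S s'
  else True.

(** A polynomial relation between the elements of a chain is a polynomial relation
for the head, with coefficients in the field generated by the tail; all these
coefficients vanish, and they are themselves relations between the tail. *)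
Lemma transcendental_chain_free S s n (c : (size s).-tuple 'I_n -> F) :
    transcendental_chain S s -> (forall e, fieldgen S (c e)) ->
    \sum_e c e * monom s (map val e) = 0 ->
  forall e, c e = 0.
Proof.
elim: s c => [|x s IHs] /= c.
  move=> _ _ c0 e; move: c0; rewrite (big_pred1 e)/=; last first.
    move=> e' /=; apply/esym/eqP; apply: val_inj.
    by rewrite (tuple0 e') (tuple0 e).
  by rewrite /monom big_ord0 mulr1.
move=> [trx chs] Sc c0.
pose r (p : 'I_n * (size s).-tuple 'I_n) : (size s).+1.-tuple 'I_n := cons_tuple p.1 p.2.
pose r' (e : (size s).+1.-tuple 'I_n) := (thead e, [tuple of behead e]).
have rK : cancel r r'.
  by case=> i e; rewrite /r /r' /=; congr (_, _); apply: val_inj.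
have r'K : cancel r' r by move=> e; rewrite /r /r' /= [RHS]tuple_eta; apply: val_inj.
pose d (i : 'I_n) := \sum_e c (r (i, e)) * monom s (map val e).
have d0 : forall i, d i = 0.
  apply: trx.
    move=> i; apply: fieldgen_sum => e _; apply: fieldgenM.
      by apply: fieldgenS (Sc _) => y; left.
    apply: fieldgen_prod => j _; apply: fieldgenX; apply: fieldgen_in; right.
    exact: mem_nth.
  rewrite -[RHS]c0 [RHS](reindex r); last first.
    by exists r' => ? _; [exact: rK | exact: r'K].
  rewrite -(pair_bigA _ (fun i e => c (r (i, e)) * monom (x :: s) (map val (r (i, e)))))/=.
  apply: eq_bigr => i _; rewrite mulr_suml; apply: eq_bigr => e _.
  by rewrite monom_cons mulrAC mulrA.
move=> e; rewrite -(r'K e); case: (r' e) => i e'.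
by apply: (IHs (fun e => c (r (i, e)))) => //; apply: d0.
Qed.

Lemma fieldgen_dependence_fin S (I J : finType) (m : J -> F) (u : I -> F)
    (A : I -> J -> F) :
    (#|J| < #|I|)%N -> (forall i j, fieldgen S (A i j)) ->
    (forall i, u i = \sum_j A i j * m j) ->
  exists c : I -> F, [/\ forall i, fieldgen S (c i), exists i, c i != 0
    & \sum_i c i * u i = 0].
Proof.
move=> ltJI SA uE.
have [|c [Sc [i0 c0] cA]] :=
  @fieldgen_dependence F S #|J| #|I| (fun i j => A (enum_val i) (enum_val j)) ltJI.
  by move=> i j; apply: SA.
exists (fun i => c (enum_rank i)); split=> //.
  by exists (enum_val i0); rewrite enum_valK.
under eq_bigr do rewrite uE mulr_sumr.
rewrite exchange_big big1 //= => j _.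
under eq_bigr do rewrite mulrA.
rewrite -mulr_suml; apply/eqP; rewrite mulf_eq0; apply/orP; left; apply/eqP.
rewrite -[RHS](cA (enum_rank j)) [RHS](reindex (@enum_rank I)); last first.
  exact/onW_bij/enum_rank_bij.
by apply: eq_bigr => i _; rewrite !enum_rankK.
Qed.

(** Among the M^b monomials with exponents less than M in the b elements of [s],
which up to a common factor are combinations of O(M)^a monomials in the a
elements of [l], there is a linear relation as soon as a < b and M is large;
it contradicts the independence of the chain. *)
Lemma transcendental_chain_size S s l : transcendental_chain S s ->
  (forall x, x \in s -> fieldgen (S `|` [set` l]) x) -> (size s <= size l)%N.
Proof.
move=> chs sl; rewrite leqNgt; apply/negP => ltls.
set a := size l; set b := size s.
have [d [q [dq q0 dtq]]] := @fieldgen_common_denominator S l b (fun i => s`_i)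
  (fun i => sl _ (mem_nth 0 (ltn_ord i))).
(* M is chosen so that ((b * d + 1) * M) ^ a < M * M ^ a <= M ^ b. *)
pose M := ((b * d + 1) ^ a).+1%N.
pose D := (b * (d * M))%N.
have dmon (e : b.-tuple 'I_M) : poly_in S l D (monom s (map val e) * q ^+ (b * M)).
  have -> : monom s (map val e) * q ^+ (b * M) =
      \prod_(i < b) ((s`_i * q) ^+ tnth e i * q ^+ (M - tnth e i)).
    rewrite mulnC exprM -{2}(card_ord b) -prodr_const -big_split/=.
    apply: eq_bigr => i _; rewrite exprMn -mulrA -exprD subnKC; last exact/ltnW.
    by rewrite (nth_map (tnth e i)) ?size_tuple// -tnth_nth.
  rewrite /D -{1}(card_ord b); apply: poly_in_prod => i _.
  have -> : (d * M = d * tnth e i + d * (M - tnth e i))%N.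
    by rewrite -mulnDr subnKC // ltnW.
  by apply: poly_inM; apply: poly_inX.
have /choice [A SA] : forall e : b.-tuple 'I_M, exists A : a.-tuple 'I_D.+1 -> F,
    (forall f, fieldgen S (A f)) /\
    monom s (map val e) * q ^+ (b * M) = \sum_f A f * monom l (map val f).
  by move=> e; have [A SA AE] := poly_in_coord (dmon e); exists A.
have ltcard : (#|{: a.-tuple 'I_D.+1}| < #|{: b.-tuple 'I_M}|)%N.
  rewrite !card_tuple !card_ord -/a -/b.
  have leD : (D.+1 <= (b * d + 1) * M)%N by rewrite /D /M; lia.
  apply: (@leq_ltn_trans (((b * d + 1) * M) ^ a)); first by case: (a) => // k; rewrite leq_exp2r.
  rewrite expnMn; apply: (@leq_trans (M * M ^ a)).
    by rewrite ltn_mul2r expn_gt0 /= /M ltnS leqnn.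
  by rewrite -expnS leq_pexp2l.
have [c [Sc [e c0] cu]] := fieldgen_dependence_fin ltcard (fun e => (SA e).1)
  (fun e => (SA e).2).
move: c0; rewrite (transcendental_chain_free chs Sc) ?eqxx//.
apply: (mulIf (expf_neq0 (b * M) q0)); rewrite mul0r -[RHS]cu mulr_suml.
by apply: eq_bigr => f _; rewrite mulrA.
Qed.

End Counting.

(** * Generic perturbations of a power series *)

Section Countability.
Variable F : closedFieldType.
Implicit Types (S : set F).

(** Arithmetic expressions over countably many constants, encoded by trees in
order to inherit their countability: the label of a node is the operation (0 for
the additive ones, 1 for the multiplicative ones), its arity tells the binary
operation from the inverse, and every other node denotes 1. *)
Fixpoint term_value (g : nat -> F) (t : GenTree.tree nat) : F :=
  match t with
  | GenTree.Leaf n => g n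
  | GenTree.Node 0 [:: s; t] => term_value g s + term_value g t
  | GenTree.Node 1 [:: s; t] => term_value g s * term_value g t
  | GenTree.Node 0 [:: s] => - term_value g s
  | GenTree.Node 1 [:: s] => (term_value g s)^-1
  | _ => 1
  end.

Lemma fieldgen_terms S : countable S ->
  exists v : GenTree.tree nat -> F, fieldgen S `<=` range v.
Proof.
move=> /countable_injP[f f_inj].
pose g n := xget 0 [set x | S x /\ f x = n].
exists (term_value g) => x; elim=> {x}
  [x Sx||x y _ [s _ <-] _ [t _ <-]|x _ [s _ <-]|x y _ [s _ <-] _ [t _ <-]|x _ [s _ <-]].
- exists (GenTree.Leaf (f x)) => //=; rewrite /g.
  case: xgetP => [y _ [Sy fy]|/(_ x)]; last by case; split.
  by apply: f_inj; rewrite ?inE.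
- by exists (GenTree.Node 0 [::]).
- by exists (GenTree.Node 0 [:: s; t]).
- by exists (GenTree.Node 0 [:: s]).
- by exists (GenTree.Node 1 [:: s; t]).
- by exists (GenTree.Node 1 [:: s]).
Qed.

Lemma countable_roots (p : {poly F}) : p != 0 -> countable [set x | root p x].
Proof.
move=> p0; have [r pE] := closed_field_poly_normal p.
apply: finite_set_countable; apply: (sub_finite_set _ (finite_seq r)) => x /=.
by rewrite pE rootZ ?lead_coef_eq0// root_prod_XsubC.
Qed.

(** There are countably many polynomials over a countable field, and each has
finitely many roots. *)
Lemma countable_algebraic S : countable S ->
  countable [set x | ~ transcendental_over S x].
Proof.
move=> /fieldgen_terms[v Sv].
pose p (s : seq (GenTree.tree nat)) : {poly F} := Poly (map v s).
pose A (s : seq (GenTree.tree nat)) := [set x | p s != 0 /\ root (p s) x].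
apply: (@sub_countable _ _ _ (\bigcup_(s in [set: seq (GenTree.tree nat)]) A s)); last first.
  apply: bigcup_countable => [|s _]; first exact: countableP.
  have [ps0|ps0] := eqVneq (p s) 0.
    rewrite (_ : A s = set0); first exact: countable0.
    by apply/seteqP; split=> x //; rewrite /A/= ps0 eqxx => -[].
  apply: sub_countable (countable_roots ps0).
  by apply: subset_card_le => x [].
apply: subset_card_le => x /= /existsNP[n /existsNP[c]].
move=> /not_implyP[Sc /not_implyP[cx /existsNP[i ci]]].
have /choice[s sE] : forall j : 'I_n, exists t, v t = c j.
  by move=> j; have [t _ tE] := Sv _ (Sc j); exists t.
have pE (j : 'I_n) : (p [seq s k | k <- enum 'I_n])`_j = c j.
  rewrite coef_Poly -map_comp (nth_map j) ?size_enum_ord//=.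
  by rewrite nth_ord_enum sE.
exists [seq s k | k <- enum 'I_n] => //; split.
  by apply/negP => /eqP p0; apply: ci; rewrite -pE p0 coef0.
apply/eqP; rewrite -[RHS]cx (@horner_coef_wide _ n).
  by apply: eq_bigr => j _; rewrite pE.
by rewrite (leq_trans (size_Poly _))// 2!size_map size_enum_ord.
Qed.

End Countability.

Section Generic.
Variable R : realType.
Implicit Types (S : set R[i]) (F : fps2 R).

(** A segment of positive length is uncountable, hence not made of algebraic
numbers only.  The displacement is real and positive, so that its modulus is
itself. *)
Lemma exists_transcendental_near S (z : R[i]) (r : R) : countable S -> 0 < r ->
  exists2 e : R, 0 < e < r & transcendental_over S (z + e%:C%C).
Proof.
move=> /countable_algebraic cA r0; apply: contrapT => h.
have : countable `]0, r[%classic.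
  apply: sub_countable cA.
  pose f (e : R) := z + e%:C%C.
  have sub : f @` `]0, r[ `<=` [set x | ~ transcendental_over S x].
    move=> x [e /=]; rewrite in_itv/= => er <- trans.
    by apply: h; exists e.
  apply: card_le_trans (subset_card_le sub).
  have f_inj : {in `]0, r[%classic &, injective f} by move=> x y _ _ /addrI -[].
  by have /card_eqPle[] := inj_card_eq f_inj.
move=> /countable_lebesgue_measure0.
rewrite lebesgue_measure_itv/= lte_fin r0 -EFinB subr0 => -[].
by move=> re; move: r0; rewrite re ltxx.
Qed.

Definition initial_segment (t : nat -> R[i]) n := [seq t k | k <- rev (iota 0 n)].

Lemma initial_segmentS t n : initial_segment t n.+1 = t n :: initial_segment t n.
Proof. by rewrite /initial_segment -addn1 iotaD rev_cat. Qed.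

Lemma countable_seq_setU S (s : seq R[i]) : countable S -> countable (S `|` [set` s]).
Proof.
move=> cS; rewrite -bigcup2E; apply: bigcup_countable => // -[|[|n]] _ //=.
  exact/finite_set_countable/finite_seq.
Qed.

Lemma generic_sequence S (u : nat -> R[i]) (rho : nat -> R) :
    countable S -> (forall n, 0 < rho n) ->
  exists h : nat -> R, (forall n, 0 < h n < rho n) /\
    forall n, transcendental_chain S (initial_segment (fun k => u k + (h k)%:C%C) n).
Proof.
move=> cS rho0.
have /choice[g gP] : forall p : nat * seq R[i], exists e : R,
    0 < e < rho p.1 /\ transcendental_over (S `|` [set` p.2]) (u p.1 + e%:C%C).
  move=> [n s]; have [e e1 e2] :=
    exists_transcendental_near (u n) (countable_seq_setU s cS) (rho0 n).
  by exists e.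
(* The list of the terms already chosen, the most recent one first. *)
pose past := fix past n := if n is m.+1 then (u m + (g (m, past m))%:C%C) :: past m else [::].
exists (fun n => g (n, past n)); split=> [n|n]; first by have [] := gP (n, past n).
suff -> : initial_segment (fun k => u k + (g (k, past k))%:C%C) n = past n.
  by elim: n => //= n IHn; split => //; have [] := gP (n, past n).
by elim: n => // n IHn; rewrite initial_segmentS IHn.
Qed.

Lemma normc_real (x : R) : Normc.normc x%:C%C = `|x|.
Proof. by rewrite /Normc.normc/= expr0n addr0 sqrtr_sqr. Qed.

Lemma fps2_convergentD F (h : nat * nat -> R) : fps2_convergent F ->
    (forall ij, 0 <= h ij <= 2^-1 ^+ (pickle ij)) ->
  fps2_convergent (fun i j => F i j + (h (i, j))%:C%C).
Proof.
move=> [r r0 Fr] hb; exists (Num.min r 1); first by rewrite lt_min r0 ltr01.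
move=> x y; rewrite !lt_min => /andP[xr x1] /andP[yr y1].
pose f ij : \bar R := (Normc.normc (F ij.1 ij.2 * x ^+ ij.1 * y ^+ ij.2))%:E.
pose k (ij : nat * nat) : \bar R := (2^-1 ^+ (pickle ij))%:E.
have normcX z n : Normc.normc (z ^+ n) = Normc.normc (z : R[i]) ^+ n.
  elim: n => [|n IHn]; first by rewrite !expr0 Normc.normc1.
  by rewrite !exprS Normc.normcM IHn.
have normc_ge0 (z : R[i]) : 0 <= Normc.normc z by case: z => a b; apply: sqrtr_ge0.
have fk : summable [set: nat * nat] (f \+ k).
  apply: summableD; first exact: Fr.
  rewrite /summable.
  under eq_esum do rewrite gee0_abs ?lee_fin ?exprn_ge0 ?invr_ge0//.
  rewrite -(@esum_image R _ _ setT pickle (fun n => (2^-1 ^+ n)%:E)); last first.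
    by move=> a b _ _ /(pcan_inj pickleK).
  rewrite esum_mkcond.
  apply: (@le_lt_trans _ _ (\esum_(n in [set: nat]) (2 / (2 ^ n.+1)%:R)%:E)%E).
    apply: le_esum => n _; case: ifP => _; last by rewrite lee_fin divr_ge0.
    by rewrite lee_fin natrX exprS invfM mulrA divff ?mul1r ?exprVn.
  rewrite -nneseries_esumT; last by move=> n; rewrite lee_fin divr_ge0.
  by apply: le_lt_trans (epsilon_trick0 _ _) _; rewrite ?ltry.
apply: le_lt_trans fk; apply: le_esum => -[i j] _ /=.
rewrite lee_fin !ger0_norm ?addr_ge0 ?exprn_ge0 ?invr_ge0//.
rewrite !mulrDl; apply: le_trans (le_normcD _ _) _.
apply: lerD => //; have /andP[h0 hk] := hb (i, j).
rewrite !Normc.normcM !normcX normc_real ger0_norm//.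
apply: le_trans hk; rewrite -mulrA ler_piMr//.
by apply: mulr_ile1; rewrite ?exprn_ge0//; apply: exprn_ile1 => //; apply: ltW.
Qed.

(** The coefficients are indexed by their codes [pickle (i, j)]; the bound
2^(- pickle (i, j)) on the displacements makes the perturbation absolutely
summable on the unit polydisc, whence convergence. *)
Lemma generic_perturbation S F (N0 : nat) (eps : R) :
    countable S -> 0 < eps -> fps2_convergent F ->
  exists G : fps2 R, [/\ fps2_convergent G, jet N0 F = jet N0 G,
    (fps2_norm (F - G)%R < eps%:E)%E &
    exists t : nat -> R[i], (forall n, transcendental_chain S (initial_segment t n)) /\
      forall i j, (N0 < i + j)%N -> G i j = t (pickle (i, j))].
Proof.
move=> cS eps0 Fc.
pose u n := if (unpickle n : option (nat * nat)) is Some ij then F ij.1 ij.2 else 0.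
pose rho n : R := Num.min (2^-1 ^+ n) (eps / 2).
have rho0 n : 0 < rho n by rewrite lt_min exprn_gt0 ?divr_gt0 ?invr_gt0.
have [h [hb hchain]] := generic_sequence u cS rho0.
pose h' (ij : nat * nat) := if (ij.1 + ij.2 <= N0)%N then 0 else h (pickle ij).
have h'b ij : 0 <= h' ij <= rho (pickle ij).
  rewrite /h'; case: ifP => _; first by rewrite lexx ltW.
  by have /andP[h0 h1] := hb (pickle ij); rewrite !ltW.
exists (fun i j => F i j + (h' (i, j))%:C%C); split.
- apply: fps2_convergentD => // ij; have /andP[-> /=] := h'b ij.
  by rewrite le_min => /andP[].
- apply/funext => i; apply/funext => j; rewrite /jet /h' /=.
  by case: ifP => // _; rewrite addr0.
- apply: (@le_lt_trans _ _ (eps / 2)%:E); last by rewrite lte_fin ltr_pdivrMr// ltr_pMr// ltr1n.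
  apply: ge_ereal_sup => _ [[i j] _ <-] /=; rewrite lee_fin.
  rewrite (_ : (F - _) i j = - (h' (i, j))%:C%C); last first.
    by rewrite -[LHS]/(F i j - (F i j + _)) opprD addrA subrr add0r.
  rewrite normcN normc_real; have /andP[h0] := h'b (i, j).
  by rewrite le_min => /andP[_ he]; rewrite ger0_norm.
exists (fun k => u k + (h k)%:C%C); split=> // i j ij.
by rewrite /u pickleK /h' /= leqNgt ij.
Qed.

End Generic.

(** * The ring of formal power series *)

Section Ring.
Variable R : realType.
Implicit Types (F G H : fps2 R).

Definition trunc_poly (n : nat) F : {poly {poly R[i]}} :=
  \poly_(i < n) \poly_(j < n) F i j.

Lemma coef_trunc_poly n F i j : (i < n)%N -> (j < n)%N ->
  (trunc_poly n F)`_i`_j = F i j.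
Proof. by move=> i_n j_n; rewrite !coef_poly i_n coef_poly j_n. Qed.

Lemma coef2M (p q : {poly {poly R[i]}}) k l : (p * q)`_k`_l =
  \sum_(i < k.+1) \sum_(j < l.+1) p`_i`_j * q`_(k - i)`_(l - j).
Proof. by rewrite coefM coef_sum; apply: eq_bigr => i _; rewrite coefM. Qed.

Lemma fps2_mul_trunc n F G k l : (k < n)%N -> (l < n)%N ->
  fps2_mul F G k l = (trunc_poly n F * trunc_poly n G)`_k`_l.
Proof.
move=> kn ln; rewrite coef2M; apply: eq_bigr => i _; apply: eq_bigr => j _.
by rewrite !coef_trunc_poly //; have := ltn_ord i; have := ltn_ord j; lia.
Qed.

(** A coefficient of a product depends on finitely many coefficients of the
factors, so the identities of a ring follow from those of polynomials. *)
Lemma fps2_mulA : associative (@fps2_mul R).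
Proof.
move=> F G H; apply/funext => k; apply/funext => l; pose n := (k + l).+1.
have tr (A B : fps2 R) (p q : {poly {poly R[i]}}) :
    (forall i j, (i <= k)%N -> (j <= l)%N -> A i j = p`_i`_j) ->
    (forall i j, (i <= k)%N -> (j <= l)%N -> B i j = q`_i`_j) ->
  forall i j, (i <= k)%N -> (j <= l)%N -> fps2_mul A B i j = (p * q)`_i`_j.
  move=> Ap Bq i j ik jl; rewrite coef2M; apply: eq_bigr => i' _.
  apply: eq_bigr => j' _; have := ltn_ord i'; have := ltn_ord j' => *.
  by rewrite Ap ?Bq//; lia.
have trn A i j : (i <= k)%N -> (j <= l)%N -> A i j = (trunc_poly n A)`_i`_j.
  by move=> *; rewrite coef_trunc_poly// /n; lia.
have Hl := tr _ _ _ _ (trn F) (tr _ _ _ _ (trn G) (trn H)).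
have Hr := tr _ _ _ _ (tr _ _ _ _ (trn F) (trn G)) (trn H).
by rewrite Hl// Hr// mulrA.
Qed.

Lemma fps2_mulC : commutative (@fps2_mul R).
Proof.
move=> F G; apply/funext => k; apply/funext => l.
by rewrite !(@fps2_mul_trunc (k + l).+1) 1?mulrC//; lia.
Qed.

Lemma fps2_mul1 : left_id (@fps2_one R) (@fps2_mul R).
Proof.
move=> F; apply/funext => k; apply/funext => l.
rewrite /fps2_mul big_ord_recl/= big_ord_recl/= /fps2_one/= !subn0 mul1r.
rewrite big1 => [|i _]; last by rewrite /bump /= mul0r.
by rewrite big1 ?addr0// => i _; rewrite big1// => j _; rewrite mul0r.
Qed.

Lemma fps2_mulD : left_distributive (@fps2_mul R) +%R.
Proof.
move=> F G H; apply/funext => k; apply/funext => l.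
rewrite -[RHS]/(fps2_mul F H k l + fps2_mul G H k l) /fps2_mul -big_split.
apply: eq_bigr => i _; rewrite -big_split; apply: eq_bigr => j _.
exact: mulrDl.
Qed.

Lemma fps2_one_neq0 : @fps2_one R != 0.
Proof.
apply/eqP => /(congr1 (fun F : fps2 R => F 0 0)%N) /eqP.
by rewrite /fps2_one /= oner_eq0.
Qed.

HB.instance Definition _ := GRing.Zmodule_isComNzRing.Build (fps2 R)
  fps2_mulA fps2_mulC fps2_mul1 fps2_mulD fps2_one_neq0.

Lemma fps2_mulE F G : fps2_mul F G = F * G. Proof. by []. Qed.
Lemma fps2_expE F n : fps2_exp F n = F ^+ n.
Proof. by elim: n => // n IHn; rewrite exprS -IHn. Qed.

Lemma fps2_coefD F G i j : (F + G) i j = F i j + G i j. Proof. by []. Qed.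
Lemma fps2_coefN F i j : (- F) i j = - F i j. Proof. by []. Qed.
Lemma fps2_coef_sum (I : Type) (r : seq I) (P : pred I) (f : I -> fps2 R) i j :
  (\sum_(k <- r | P k) f k) i j = \sum_(k <- r | P k) f k i j.
Proof. by elim/big_rec2: _ => // k y1 y2 _ <-. Qed.

Lemma fps2_coefMn F n i j : (F *+ n) i j = F i j *+ n.
Proof. by elim: n => // n IHn; rewrite !mulrS fps2_coefD IHn. Qed.

End Ring.

(** * Leading monomials and composition *)

(** Degree first, then the exponent of x: a total order compatible with products,
for which a nonzero series has a least monomial. *)
Definition monom_lt (i j p q : nat) : bool :=
  ((i + j < p + q) || ((i + j == p + q) && (i < p)))%N.

Lemma exists_least_monom (P : nat -> nat -> Prop) : (exists i j, P i j) ->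
  exists p q, P p q /\ forall i j, monom_lt i j p q -> ~ P i j.
Proof.
move=> [i0 [j0 Pij]].
pose D d := `[< exists i j, P i j /\ (i + j = d)%N >].
have exD : exists d, D d by exists (i0 + j0)%N; apply/asboolP; exists i0, j0.
case: (ex_minnP exD) => d /asboolP[i2 [j2 [Pij2 d2]]] dmin.
pose E i := `[< exists j, P i j /\ (i + j = d)%N >].
have exE : exists i, E i by exists i2; apply/asboolP; exists j2.
case: (ex_minnP exE) => p /asboolP[q [Ppq pq]] pmin.
exists p, q; split=> // i j ij Pij'.
have := dmin (i + j)%N; have := pmin i; rewrite /D /E /monom_lt in ij *.
case: (eqVneq (i + j)%N d) => [ijd|ijd].
  move=> h _; suff : (p <= i)%N by lia.
  by apply: h; apply/asboolP; exists j.
move=> _ h; suff : (d <= i + j)%N by lia.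
by apply: h; apply/asboolP; exists i, j.
Qed.

Section MonomialOrder.
Variable R : realType.
Implicit Types (F G H : fps2 R) (p q r s : nat).

Definition ord_ge p q F := forall i j, monom_lt i j p q -> F i j = 0.

Lemma ord_geW p q r s F : ~~ monom_lt r s p q -> ord_ge r s F -> ord_ge p q F.
Proof.
by move=> rspq Frs i j ijpq; apply: Frs; move: rspq ijpq; rewrite /monom_lt; lia.
Qed.

Lemma ord_ge00 F : ord_ge 0 0 F.
Proof. by move=> i j; rewrite /monom_lt; lia. Qed.

Lemma ord_geD p q F G : ord_ge p q F -> ord_ge p q G -> ord_ge p q (F + G).
Proof. by move=> Fpq Gpq i j ij; rewrite fps2_coefD Fpq// Gpq// addr0. Qed.

Lemma ord_geN p q F : ord_ge p q F -> ord_ge p q (- F).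
Proof. by move=> Fpq i j ij; rewrite fps2_coefN Fpq// oppr0. Qed.

Lemma ord_ge_sum p q (I : Type) (r : seq I) (P : pred I) (f : I -> fps2 R) :
  (forall k, P k -> ord_ge p q (f k)) -> ord_ge p q (\sum_(k <- r | P k) f k).
Proof. by move=> fpq i j ij; rewrite fps2_coef_sum big1// => k /fpq ->. Qed.

Lemma fps2_coefM F G k l : (F * G) k l =
  \sum_(i < k.+1) \sum_(j < l.+1) F i j * G (k - i)%N (l - j)%N.
Proof. by []. Qed.

Lemma ord_geM p q r s F G : ord_ge p q F -> ord_ge r s G ->
  ord_ge (p + r) (q + s) (F * G).
Proof.
move=> Fpq Grs k l kl; rewrite fps2_coefM big1// => i _; rewrite big1// => j _.
have := ltn_ord i; have := ltn_ord j => ? ?.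
have [ij|ij] := boolP (monom_lt i j p q); first by rewrite Fpq// mul0r.
by rewrite Grs ?mulr0//; move: ij kl; rewrite /monom_lt; lia.
Qed.

Lemma ord_ge_lead p q r s F G : ord_ge p q F -> ord_ge r s G ->
  (F * G) (p + r)%N (q + s)%N = F p q * G r s.
Proof.
move=> Fpq Grs; rewrite fps2_coefM.
have pP : (p < (p + r).+1)%N by lia.
have qP : (q < (q + s).+1)%N by lia.
rewrite (bigD1 (Ordinal pP))//= (bigD1 (Ordinal qP))//= !addKn.
rewrite big1 ?addr0 => [|j]; last first.
  rewrite -val_eqE /= => jq; have := ltn_ord j => ?.
  have [ij|ij] := boolP (monom_lt p j p q); first by rewrite Fpq// mul0r.
  by rewrite Grs ?mulr0//; move: ij; rewrite /monom_lt; lia.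
rewrite big1 ?addr0// => i; rewrite -val_eqE /= => ip; rewrite big1// => j _.
have := ltn_ord i; have := ltn_ord j => ? ?.
have [ij|ij] := boolP (monom_lt i j p q); first by rewrite Fpq// mul0r.
by rewrite Grs ?mulr0//; move: ij; rewrite /monom_lt; lia.
Qed.

Lemma ord_geX p q F n : ord_ge p q F -> ord_ge (p * n) (q * n) (F ^+ n).
Proof.
move=> Fpq; elim: n => [|n IHn]; first by rewrite !muln0; apply: ord_ge00.
by rewrite exprS !mulnS; apply: ord_geM.
Qed.

Lemma ord_ge_leadX p q F n : ord_ge p q F ->
  (F ^+ n) (p * n)%N (q * n)%N = F p q ^+ n.
Proof.
move=> Fpq; elim: n => [|n IHn]; first by rewrite !muln0 !expr0.
by rewrite !exprS !mulnS (ord_ge_lead Fpq (ord_geX (n := n) Fpq)) IHn.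
Qed.

Lemma exists_lead F : F <> 0 -> exists p q, F p q != 0 /\ ord_ge p q F.
Proof.
move=> F0; have [|p [q [Fpq Fmin]]] := @exists_least_monom (fun i j => F i j != 0).
  apply: contrapT => h; apply: F0; apply/funext => i; apply/funext => j.
  by apply: contrapT => /eqP Fij; apply: h; exists i, j.
by exists p, q; split=> // i j /Fmin /negP; rewrite negbK => /eqP.
Qed.

Lemma fps2_mulf_neq0 F G : F <> 0 -> G <> 0 -> F * G <> 0.
Proof.
move=> /exists_lead[p [q [F0 Fpq]]] /exists_lead[r [s [G0 Grs]]] FG.
have := ord_ge_lead Fpq Grs; rewrite FG => /esym/eqP.
by rewrite mulf_eq0 (negPf F0) (negPf G0).
Qed.

End MonomialOrder.

Section Composition.
Variable R : realType.
Implicit Types (F G H : fps2 R) (phi psi h : fps2 R) (p q r s : nat).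

Definition fps2_cst (c : R[i]) : fps2 R := fun i j => c *+ ((i == 0%N) && (j == 0%N)).

Lemma fps2_cstM c F i j : (fps2_cst c * F) i j = c * F i j.
Proof.
rewrite fps2_coefM big_ord_recl/= big_ord_recl/= /fps2_cst/= !subn0.
rewrite big1 => [|k _]; last by rewrite /bump /= mul0r.
by rewrite addr0 big1 ?addr0// => k _; rewrite big1// => l _; rewrite mul0r.
Qed.

Lemma big_ord_vanish (V : nmodType) m n (f : nat -> V) : (m <= n)%N ->
  (forall i, (m <= i)%N -> f i = 0) -> \sum_(i < n) f i = \sum_(i < m) f i.
Proof.
move=> mn f0; rewrite -!(big_mkord xpredT) (big_cat_nat (n := m))//=.
by rewrite [X in _ + X]big_nat_cond [X in _ + X]big1 ?addr0// => i; rewrite andbT => /andP[/f0].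
Qed.

Lemma ord_ge_powers phi psi i j : ord_ge 0 1 phi -> ord_ge 0 1 psi ->
  ord_ge 0 (i + j) (phi ^+ i * psi ^+ j).
Proof.
move=> hphi hpsi; have := ord_geM (ord_geX (n := i) hphi) (ord_geX (n := j) hpsi).
by rewrite !mul0n !mul1n.
Qed.

Lemma powers_coef0 phi psi i j k l : ord_ge 0 1 phi -> ord_ge 0 1 psi ->
  (k + l < i + j)%N -> (phi ^+ i * psi ^+ j) k l = 0.
Proof.
by move=> hphi hpsi kl; apply: (ord_ge_powers hphi hpsi); rewrite /monom_lt; lia.
Qed.

Lemma fps2_comp_wide F phi psi m n k l : ord_ge 0 1 phi -> ord_ge 0 1 psi ->
    (k + l < m)%N -> (k + l < n)%N ->
  fps2_comp F (phi, psi) k l =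
  \sum_(i < m) \sum_(j < n) F i j * (phi ^+ i * psi ^+ j) k l.
Proof.
move=> hphi hpsi klm kln; rewrite /fps2_comp /=.
rewrite [RHS](big_ord_vanish (f := fun i =>
  \sum_(j < n) F i j * (phi ^+ i * psi ^+ j) k l) klm); last first.
  move=> i kli; rewrite big1// => j _.
  by rewrite powers_coef0 ?mulr0//; lia.
apply: eq_bigr => i _.
rewrite [RHS](big_ord_vanish (f := fun j => F i j * (phi ^+ i * psi ^+ j) k l) kln).
  by apply: eq_bigr => j _; rewrite !fps2_expE.
by move=> j klj; rewrite powers_coef0 ?mulr0//; lia.
Qed.

Lemma fps2_coefM_local F F' G G' k l :
    (forall i j, (i <= k)%N -> (j <= l)%N -> F i j = F' i j) ->
    (forall i j, (i <= k)%N -> (j <= l)%N -> G i j = G' i j) ->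
  (F * G) k l = (F' * G') k l.
Proof.
move=> FF GG; rewrite !fps2_coefM; apply: eq_bigr => i _; apply: eq_bigr => j _.
by have := ltn_ord i; have := ltn_ord j => ? ?; rewrite FF ?GG//; lia.
Qed.

Lemma exprB_first_order (A : comNzRingType) (x y : A) n : exists r : A,
  (x - y) ^+ n = x ^+ n - y * (x ^+ n.-1 *+ n) + y ^+ 2 * r.
Proof.
elim: n => [|n [r IHn]]; first by exists 0; rewrite !expr0 mulr0n; ring.
exists ((x - y) * r + x ^+ n.-1 *+ n); rewrite exprS IHn /=.
have xn : x * (x ^+ n.-1 *+ n) = x ^+ n *+ n.
  by case: n {IHn} => [|n]; rewrite ?mulr0n ?mulr0// mulrnAr exprS.
rewrite [x ^+ n.+1]exprS mulrSr -xn; ring.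
Qed.

(** Taylor expansion in the second variable, stopped after the linear term: the
remainder is divisible by [h ^+ 2]. *)
Lemma fps2_comp_first_order F phi psi h p q : ord_ge 0 1 phi -> ord_ge 0 1 psi ->
    ord_ge 0 1 h -> ord_ge p q h ->
  ord_ge (p + p) (q + q) (fps2_comp F (phi, psi - h) - fps2_comp F (phi, psi)
    + h * fps2_comp (fps2_dy F) (phi, psi)).
Proof.
move=> hphi hpsi hh hpq k l kl; pose n := (k + l).+1.
have hpsih : ord_ge 0 1 (psi - h) by apply: ord_geD => //; apply: ord_geN.
pose D := \sum_(i < n) \sum_(j < n.+1)
  fps2_cst (F i j) * (phi ^+ i * (psi ^+ j.-1 *+ j)).
have DE i j : (i <= k)%N -> (j <= l)%N ->
    fps2_comp (fps2_dy F) (phi, psi) i j = D i j.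
  move=> ik jl; rewrite (@fps2_comp_wide _ _ _ n n)//; try (rewrite /n; lia).
  rewrite /D fps2_coef_sum; apply: eq_bigr => i' _.
  rewrite fps2_coef_sum [RHS]big_ord_recl/= fps2_cstM mulr0n mulr0 mulr0 add0r.
  apply: eq_bigr => j' _; rewrite fps2_cstM /fps2_dy /bump /= add1n.
  by rewrite mulrnAr fps2_coefMn mulrnAl mulrnAr.
rewrite fps2_coefD fps2_coefD fps2_coefN.
rewrite (@fps2_coefM_local h h _ D)//.
rewrite !(@fps2_comp_wide _ _ _ n n.+1)//; try (rewrite /n; lia).
pose T : fps2 R := \sum_(i < n) \sum_(j < n.+1) fps2_cst (F i j) *
  (phi ^+ i * ((psi - h) ^+ j - psi ^+ j + h * (psi ^+ j.-1 *+ j))).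
suff -> : \sum_(i < n) \sum_(j < n.+1) F i j * (phi ^+ i * (psi - h) ^+ j) k l -
    \sum_(i < n) \sum_(j < n.+1) F i j * (phi ^+ i * psi ^+ j) k l +
    (h * D) k l = T k l.
  suff : ord_ge (p + p) (q + q) T by apply.
  apply: ord_ge_sum => i _; apply: ord_ge_sum => j _.
  have [r ->] := exprB_first_order psi h j.
  have -> : fps2_cst (F i j) * (phi ^+ i * (psi ^+ j - h * (psi ^+ j.-1 *+ j)
      + h ^+ 2 * r - psi ^+ j + h * (psi ^+ j.-1 *+ j))) =
      (h * h) * (fps2_cst (F i j) * phi ^+ i * r) by ring.
  rewrite -(addn0 (p + p)%N) -(addn0 (q + q)%N).
  by apply: ord_geM; [exact: ord_geM | exact: ord_ge00].
rewrite mulr_sumr fps2_coef_sum -sumrB -big_split/= /T fps2_coef_sum.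
apply: eq_bigr => i _; rewrite mulr_sumr !fps2_coef_sum -sumrB -big_split/=.
apply: eq_bigr => j _; rewrite -!(fps2_cstM (F i j)).
rewrite -fps2_coefN -!fps2_coefD; apply: (congr1 (fun G : fps2 R => G k l)); ring.
Qed.

(** A substitution tangent to the identity sends x^i y^j to x^i y^j plus larger
monomials, so it preserves the leading term. *)
Lemma fps2_comp_lead F phi psi p q : ord_ge 1 0 phi -> phi 1%N 0%N = 1 ->
    ord_ge 0 1 psi -> psi 0%N 1%N = 1 -> ord_ge p q F ->
  fps2_comp F (phi, psi) p q = F p q.
Proof.
move=> hphi phi1 hpsi psi1 Fpq.
have hphi' : ord_ge 0 1 phi by apply: ord_geW hphi.
have pw i j : ord_ge i j (phi ^+ i * psi ^+ j).
  have := ord_geM (ord_geX (n := i) hphi) (ord_geX (n := j) hpsi).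
  by rewrite !mul0n !mul1n addn0.
have pw1 : (phi ^+ p * psi ^+ q) p q = 1.
  have := ord_ge_lead (ord_geX (n := p) hphi) (ord_geX (n := q) hpsi).
  by rewrite !ord_ge_leadX// !mul0n !mul1n addn0 phi1 psi1 !expr1n mulr1.
rewrite (@fps2_comp_wide _ _ _ (p + q).+1 (p + q).+1)//.
have pP : (p < (p + q).+1)%N by lia.
have qP : (q < (p + q).+1)%N by lia.
rewrite (bigD1 (Ordinal pP))//= (bigD1 (Ordinal qP))//= pw1 mulr1.
rewrite big1 ?addr0 => [|j]; last first.
  rewrite -val_eqE /= => jq.
  have [ij|ij] := boolP (monom_lt p j p q); first by rewrite Fpq// mul0r.
  by rewrite pw ?mulr0//; move: ij; rewrite /monom_lt; lia.
rewrite big1 ?addr0// => i; rewrite -val_eqE /= => ip; rewrite big1// => j _.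
have [ij|ij] := boolP (monom_lt i j p q); first by rewrite Fpq// mul0r.
by rewrite pw ?mulr0//; move: ij; rewrite /monom_lt; lia.
Qed.

Lemma fps2_comp_neq0 F phi psi : ord_ge 1 0 phi -> phi 1%N 0%N = 1 ->
    ord_ge 0 1 psi -> psi 0%N 1%N = 1 -> F <> 0 ->
  fps2_comp F (phi, psi) <> 0.
Proof.
move=> hphi phi1 hpsi psi1 /exists_lead[p [q [Fpq F0]]] c0.
by move: Fpq; rewrite -(fps2_comp_lead hphi phi1 hpsi psi1 F0) c0 eqxx.
Qed.

End Composition.

(** * Propagation along the foliation equation *)

Section Core.
Variable R : realType.
Implicit Types (F G P Q X Y phi psi h : fps2 R).

Definition euler_x F : fps2 R := fun i j => F i j *+ i.
Definition euler_y F : fps2 R := fun i j => F i j *+ j.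

Lemma euler_xB F G : euler_x (F - G) = euler_x F - euler_x G.
Proof. by apply/funext => i; apply/funext => j; rewrite /euler_x mulrnBl. Qed.
Lemma euler_yB F G : euler_y (F - G) = euler_y F - euler_y G.
Proof. by apply/funext => i; apply/funext => j; rewrite /euler_y mulrnBl. Qed.

Lemma ord_ge_euler_x p q F : ord_ge p q F -> ord_ge p q (euler_x F).
Proof. by move=> Fpq i j ij; rewrite /euler_x Fpq// mul0rn. Qed.
Lemma ord_ge_euler_y p q F : ord_ge p q F -> ord_ge p q (euler_y F).
Proof. by move=> Fpq i j ij; rewrite /euler_y Fpq// mul0rn. Qed.

(** The coefficient of Phi^*(P dx + Q dy) /\ (P2 dx + Q2 dy), multiplied by xy,
with X = x P2 and Y = y Q2.  The factor xy replaces the partial derivatives by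
the Euler operators x d/dx and y d/dy, which act diagonally on monomials. *)
Definition foliation_eq P Q X Y phi psi : fps2 R :=
  (fps2_comp P (phi, psi) * euler_x phi + fps2_comp Q (phi, psi) * euler_x psi) * Y
  - (fps2_comp P (phi, psi) * euler_y phi + fps2_comp Q (phi, psi) * euler_y psi) * X.

Definition order0_part P Q X Y phi psi : fps2 R :=
  let Py := fps2_comp (fps2_dy P) (phi, psi) in
  let Qy := fps2_comp (fps2_dy Q) (phi, psi) in
  (Py * euler_x phi + Qy * euler_x psi) * Y - (Py * euler_y phi + Qy * euler_y psi) * X.

(** First variation of the equation at a solution.  Its linear part is of order 0
in h except for the two terms in which an Euler operator falls on h, so on a
monomial x^p y^q it is multiplication by a series which is affine in (p, q). *)
Lemma foliation_eq_first_order P Q X Y phi psi h p q :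
    ord_ge 0 1 phi -> ord_ge 0 1 psi -> ord_ge 0 1 h -> ord_ge p q h ->
    foliation_eq P Q X Y phi psi = 0 ->
  ord_ge (p + p) (q + q) (foliation_eq P Q X Y phi (psi - h)
    + (h * order0_part P Q X Y phi psi
       + euler_x h * (fps2_comp Q (phi, psi) * Y)
       + euler_y h * (- (fps2_comp Q (phi, psi) * X)))).
Proof.
move=> hphi hpsi hh hpq E0.
have := fps2_comp_first_order P hphi hpsi hh hpq.
have := fps2_comp_first_order Q hphi hpsi hh hpq.
rewrite /foliation_eq /order0_part in E0 *; rewrite euler_xB euler_yB.
move: E0.
move: (fps2_comp P (phi, psi)) (fps2_comp Q (phi, psi)) => Pc Qc.
move: (fps2_comp P (phi, psi - h)) (fps2_comp Q (phi, psi - h)) => P' Q'.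
move: (fps2_comp (fps2_dy P) (phi, psi)) (fps2_comp (fps2_dy Q) (phi, psi)) => Py Qy.
move=> E0; pose eP : fps2 R := P' - Pc + h * Py; pose eQ : fps2 R := Q' - Qc + h * Qy.
rewrite -/eP -/eQ => heQ heP.
have -> : P' = eP + Pc - h * Py by rewrite /eP; ring.
have -> : Q' = eQ + Qc - h * Qy by rewrite /eQ; ring.
have hx := ord_ge_euler_x hpq; have hy := ord_ge_euler_y hpq.
move: (euler_x phi) (euler_y phi) (euler_x psi) (euler_y psi) E0 => xphi yphi xpsi ypsi E0.
move: (euler_x h) (euler_y h) hx hy => xh yh hx hy.
move: {P' Q'} eP eQ heP heQ => eP eQ heP heQ.
(* The remainder: every term has a factor eP, eQ, or a product of two among h
   and its Euler derivatives. *)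
pose rest : fps2 R := eP * (xphi * Y - yphi * X)
  + eQ * ((xpsi - xh) * Y - (ypsi - yh) * X)
  + (h * xh) * (Qy * Y) - (h * yh) * (Qy * X).
have -> : ((eP + Pc - h * Py) * xphi + (eQ + Qc - h * Qy) * (xpsi - xh)) * Y -
     ((eP + Pc - h * Py) * yphi + (eQ + Qc - h * Qy) * (ypsi - yh)) * X +
     (h * ((Py * xphi + Qy * xpsi) * Y - (Py * yphi + Qy * ypsi) * X) +
      xh * (Qc * Y) + yh * - (Qc * X)) =
  ((Pc * xphi + Qc * xpsi) * Y - (Pc * yphi + Qc * ypsi) * X) + rest.
  by rewrite /rest; ring.
rewrite E0 add0r /rest.
have mul F G : ord_ge (p + p) (q + q) F -> ord_ge (p + p) (q + q) (F * G).
  move=> hF; rewrite -(addn0 (p + p)%N) -(addn0 (q + q)%N).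
  by apply: ord_geM => //; apply: ord_ge00.
apply: ord_geD; last by apply/ord_geN/mul/ord_geM.
apply: ord_geD; last exact/mul/ord_geM.
by apply: ord_geD; apply: mul.
Qed.

Definition upper_part p q F : fps2 R := fun i j => if monom_lt i j p q then 0 else F i j.

Lemma ord_ge_upper_part p q F : ord_ge p q (upper_part p q F).
Proof. by move=> i j ij; rewrite /upper_part ij. Qed.

Lemma ord_ge_upper_partW p q r s F : ord_ge r s F -> ord_ge r s (upper_part p q F).
Proof. by move=> Frs i j ij; rewrite /upper_part; case: ifP => // _; apply: Frs. Qed.

(** Let (m, n) be the least monomial of the three series that occur in the first
variation.  Then only the coefficient psi_pq of the part of psi that is cut off
contributes to the monomial (p + m, q + n), and it contributes through an affine
function of (p, q) which is not identically zero. *)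
Lemma resonance P Q X Y phi psi :
    ord_ge 0 1 phi -> ord_ge 0 1 psi ->
    foliation_eq P Q X Y phi psi = 0 -> fps2_comp Q (phi, psi) <> 0 ->
    X <> 0 \/ Y <> 0 ->
  exists m n c0 c1 c2, [/\ [\/ c0 != 0, c1 != 0 | c2 != 0] &
    forall p q, (m + n < p + q)%N ->
      foliation_eq P Q X Y phi (psi - upper_part p q psi) (p + m)%N (q + n)%N =
      - (c0 + c1 *+ p + c2 *+ q) * psi p q].
Proof.
move=> hphi hpsi E0 Q0 XY.
set Qc := fps2_comp Q (phi, psi) in Q0.
pose F0 := order0_part P Q X Y phi psi; pose F1 : fps2 R := Qc * Y; pose F2 : fps2 R := - (Qc * X).
have [|m [n [c mn]]] := @exists_least_monom
  (fun i j => [\/ F0 i j != 0, F1 i j != 0 | F2 i j != 0]).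
  case: XY => [X0|Y0].
    have /exists_lead[i [j [ij _]]] : F2 <> 0.
      by move=> /eqP; rewrite oppr_eq0 => /eqP; apply: fps2_mulf_neq0.
    by exists i, j; apply: Or33.
  have /exists_lead[i [j [ij _]]] : F1 <> 0 by apply: fps2_mulf_neq0.
  by exists i, j; apply: Or32.
have F0mn : ord_ge m n F0.
  by move=> i j ij; apply: contra_notP (mn _ _ ij) => /eqP; apply: Or31.
have F1mn : ord_ge m n F1.
  by move=> i j ij; apply: contra_notP (mn _ _ ij) => /eqP; apply: Or32.
have F2mn : ord_ge m n F2.
  by move=> i j ij; apply: contra_notP (mn _ _ ij) => /eqP; apply: Or33.
exists m, n, (F0 m n), (F1 m n), (F2 m n); split=> // p q mnpq.
set h := upper_part p q psi; have hpq : ord_ge p q h by apply: ord_ge_upper_part.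
have h01 : ord_ge 0 1 h by apply: ord_ge_upper_partW.
have := foliation_eq_first_order hphi hpsi h01 hpq E0.
rewrite -/F0 -/F1 -/F2 => /(_ (p + m)%N (q + n)%N).
rewrite !fps2_coefD !ord_ge_lead//; [|exact: ord_ge_euler_y|exact: ord_ge_euler_x].
have -> : monom_lt (p + m) (q + n) (p + p) (q + q) by rewrite /monom_lt; lia.
have hE : h p q = psi p q.
  by rewrite /h /upper_part; case: ifP => //; rewrite /monom_lt; lia.
rewrite /euler_x /euler_y hE => /(_ isT) /eqP; rewrite addr_eq0 => /eqP ->.
by move: (F0 m n) (F1 m n) (F2 m n) => a b e; ring.
Qed.

Definition coefs_in (T : set R[i]) N F := forall i j, (i + j <= N)%N -> fieldgen T (F i j).

Lemma coefs_in0 T N : coefs_in T N 0.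
Proof. by move=> i j _; apply: fieldgen0. Qed.

Lemma coefs_in1 T N : coefs_in T N 1.
Proof. by move=> i j _; apply: fieldgen_nat. Qed.

Lemma coefs_inD T N F G : coefs_in T N F -> coefs_in T N G -> coefs_in T N (F + G).
Proof. by move=> TF TG i j ij; rewrite fps2_coefD; apply: fieldgenD; auto. Qed.

Lemma coefs_inN T N F : coefs_in T N F -> coefs_in T N (- F).
Proof. by move=> TF i j ij; rewrite fps2_coefN; apply: fieldgenN; auto. Qed.

Lemma coefs_inM T N F G : coefs_in T N F -> coefs_in T N G -> coefs_in T N (F * G).
Proof.
move=> TF TG k l kl; rewrite fps2_coefM; apply: fieldgen_sum => i _.
apply: fieldgen_sum => j _; have := ltn_ord i; have := ltn_ord j => ? ?.
by apply: fieldgenM; [apply: TF | apply: TG]; lia.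
Qed.

Lemma coefs_inX T N F n : coefs_in T N F -> coefs_in T N (F ^+ n).
Proof.
move=> TF; elim: n => [|n IHn]; first by rewrite expr0; apply: coefs_in1.
by rewrite exprS; apply: coefs_inM.
Qed.

Lemma coefs_in_comp T N F phi psi : coefs_in T N F -> coefs_in T N phi ->
    coefs_in T N psi -> ord_ge 0 1 phi -> ord_ge 0 1 psi ->
  coefs_in T N (fps2_comp F (phi, psi)).
Proof.
move=> TF Tphi Tpsi hphi hpsi k l kl; apply: fieldgen_sum => i _.
apply: fieldgen_sum => j _ /=; rewrite !fps2_expE fps2_mulE.
have [ij|ij] := leqP (i + j) N.
  apply: fieldgenM; first exact: TF.
  exact: (coefs_inM (coefs_inX i Tphi) (coefs_inX j Tpsi)).
rewrite (powers_coef0 hphi hpsi) ?mulr0; first exact: fieldgen0.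
by move: ij kl; lia.
Qed.

Lemma coefs_in_foliation_eq T N P Q X Y phi psi :
    coefs_in T N P -> coefs_in T N Q -> coefs_in T N X -> coefs_in T N Y ->
    coefs_in T N phi -> coefs_in T N psi -> ord_ge 0 1 phi -> ord_ge 0 1 psi ->
  coefs_in T N (foliation_eq P Q X Y phi psi).
Proof.
move=> TP TQ TX TY Tphi Tpsi hphi hpsi.
have TPc := coefs_in_comp TP Tphi Tpsi hphi hpsi.
have TQc := coefs_in_comp TQ Tphi Tpsi hphi hpsi.
have Tx F : coefs_in T N F -> coefs_in T N (euler_x F).
  by move=> TF i j ij; apply: fieldgenMn; apply: TF.
have Ty F : coefs_in T N F -> coefs_in T N (euler_y F).
  by move=> TF i j ij; apply: fieldgenMn; apply: TF.
by apply: coefs_inD; last apply: coefs_inN; apply: coefs_inM => //; apply: coefs_inD;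
  apply: coefs_inM; auto.
Qed.

(** The zero set of a nonzero affine function lies on a graph over one of the axes, so
it has at most N + 1 points in the triangle of size N. *)
Lemma resonant_line (V : eqType) (f : nat -> nat -> V) (c0 c1 c2 : R[i]) N :
    [\/ c0 != 0, c1 != 0 | c2 != 0] ->
  exists l : seq V, (size l <= N.+1)%N /\ forall p q, (p + q <= N)%N ->
    c0 + c1 *+ p + c2 *+ q = 0 -> f p q \in l.
Proof.
move=> c.
have [c2z|c2nz] := eqVneq c2 0; last first.
  pose l := [seq f p (xget 0%N [set q | c0 + c1 *+ p + c2 *+ q = 0]) | p <- iota 0 N.+1].
  exists l; split=> [|p q pq e]; first by rewrite size_map size_iota.
  apply/mapP; exists p; first by rewrite mem_iota; lia.
  congr f; case: xgetP => [q' _ /= e'|/(_ q)//].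
  have : c2 * q%:R = c2 * q'%:R.
    by rewrite !mulr_natr; apply: addrI (etrans e (esym e')).
  by move=> /(mulfI c2nz) /eqP; rewrite eqr_nat => /eqP.
have [c1z|c1nz] := eqVneq c1 0; last first.
  pose l := [seq f (xget 0%N [set p | c0 + c1 *+ p = 0]) q | q <- iota 0 N.+1].
  exists l; split=> [|p q pq]; first by rewrite size_map size_iota.
  rewrite c2z mul0rn addr0 => e.
  apply/mapP; exists q; first by rewrite mem_iota; lia.
  congr f; case: xgetP => [p' _ /= e'|/(_ p)//].
  have : c1 * p%:R = c1 * p'%:R.
    by rewrite !mulr_natr; apply: addrI (etrans e (esym e')).
  by move=> /(mulfI c1nz) /eqP; rewrite eqr_nat => /eqP.
exists [::]; split=> // p q _; rewrite c1z c2z !mul0rn !addr0 => c00.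
by case: c; rewrite ?c00 ?c1z ?c2z eqxx.
Qed.

(** A linear bound, against which the quadratic number of coefficients of degree
at most N will be played. *)
Definition slowly_generated (S : set R[i]) F := exists r, forall N, exists l : seq R[i],
  (size l <= r * N.+1)%N /\ coefs_in (S `|` [set` l]) N F.

(** By induction along the monomial order, each psi_pq is obtained by division
from earlier coefficients, except those of small degree and those on the
resonant line, which are adjoined to the field. *)
Lemma slowly_generated_transfer S P Q X Y phi psi :
    ord_ge 0 1 phi -> ord_ge 0 1 psi ->
    foliation_eq P Q X Y phi psi = 0 -> fps2_comp Q (phi, psi) <> 0 ->
    X <> 0 \/ Y <> 0 ->
    slowly_generated S P -> slowly_generated S Q ->
    slowly_generated S X -> slowly_generated S Y -> slowly_generated S phi ->
  slowly_generated S psi.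
Proof.
move=> hphi hpsi E0 Q0 XY [rP sP] [rQ sQ] [rX sX] [rY sY] [rphi sphi].
have [m [n [c0 [c1 [c2 [c cE]]]]]] := resonance hphi hpsi E0 Q0 XY.
have [d dE] : exists d, d = (m + n)%N by exists (m + n)%N.
exists ((rP + rQ + rX + rY + rphi) * d.+1 + d.+1 * d.+1 + 4)%N => N.
(* The relation for psi_pq is read at degree p + q + d, so the other series are
   needed up to degree N + d. *)
have [lP [szP TP]] := sP (N + d)%N.
have [lQ [szQ TQ]] := sQ (N + d)%N.
have [lX [szX TX]] := sX (N + d)%N.
have [lY [szY TY]] := sY (N + d)%N.
have [lphi [szphi Tphi]] := sphi (N + d)%N.
have [lres [szres Tres]] := resonant_line psi N c.
pose llow := [seq psi p q | p <- iota 0 d.+1, q <- iota 0 d.+1].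
pose l := lP ++ lQ ++ lX ++ lY ++ lphi ++ lres ++ llow ++ [:: c0; c1; c2].
exists l; split.
  have -> : size l = (size lP + (size lQ + (size lX + (size lY + (size lphi +
      (size lres + (d.+1 * d.+1 + 3)))))))%N.
    by rewrite /l 7!size_cat /llow size_allpairs !size_iota.
  set r := (_ + rphi)%N.
  have Nd : ((N + d).+1 <= d.+1 * N.+1)%N by nia.
  have szr : (size lP + size lQ + size lX + size lY + size lphi <= r * d.+1 * N.+1)%N.
    apply: (@leq_trans (r * (N + d).+1)); first by rewrite /r !mulnDl !leq_add.
    by rewrite -mulnA leq_mul2l Nd orbT.
  have szlow : (d.+1 * d.+1 <= d.+1 * d.+1 * N.+1)%N by rewrite leq_pmulr.
  rewrite 2!mulnDl; move: szr szlow szres.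
  move: (r * d.+1 * N.+1)%N (d.+1 * d.+1)%N (d.+1 * d.+1 * N.+1)%N => ? ? ?; lia.
set T := S `|` _.
have sub l' : {subset l' <= l} -> S `|` [set` l'] `<=` T.
  by move=> l'l x [Sx|xl]; [left | right; apply: l'l].
have subl (F : fps2 R) l' : {subset l' <= l} -> coefs_in (S `|` [set` l']) (N + d) F ->
    coefs_in T (N + d) F.
  by move=> /sub l'l TF i j /TF; apply: fieldgenS.
have {}TP : coefs_in T (N + d) P.
  by apply: subl TP => x; rewrite /l !mem_cat => ->; rewrite ?orbT.
have {}TQ : coefs_in T (N + d) Q.
  by apply: subl TQ => x; rewrite /l !mem_cat => ->; rewrite ?orbT.
have {}TX : coefs_in T (N + d) X.
  by apply: subl TX => x; rewrite /l !mem_cat => ->; rewrite ?orbT.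
have {}TY : coefs_in T (N + d) Y.
  by apply: subl TY => x; rewrite /l !mem_cat => ->; rewrite ?orbT.
have {}Tphi : coefs_in T (N + d) phi.
  by apply: subl Tphi => x; rewrite /l !mem_cat => ->; rewrite ?orbT.
have step p q : (p + q <= N)%N ->
    (forall i j, monom_lt i j p q -> fieldgen T (psi i j)) -> fieldgen T (psi p q).
  move=> pqN IH; have [pqd|dpq] := leqP (p + q) d.
    apply: fieldgen_in; right; rewrite /= /l 7!mem_cat.
    have -> : psi p q \in llow by apply: allpairs_f; rewrite mem_iota; lia.
    by rewrite !orbT.
  have [res|nres] := eqVneq (c0 + c1 *+ p + c2 *+ q) 0.
    apply: fieldgen_in; right; rewrite /= /l 7!mem_cat.
    by rewrite (Tres _ _ pqN res) !orbT.
  have hp : ord_ge 0 1 (psi - upper_part p q psi).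
    by apply: ord_geD => //; apply/ord_geN/ord_ge_upper_partW.
  have Tpsi' : coefs_in T (N + d) (psi - upper_part p q psi).
    move=> i j _; rewrite fps2_coefD fps2_coefN /upper_part.
    by case: ifP => [/IH|_]; rewrite ?subr0// subrr => *; apply: fieldgen0.
  have := coefs_in_foliation_eq TP TQ TX TY Tphi Tpsi' hphi hp.
  move=> /(_ (p + m)%N (q + n)%N); rewrite cE -?dE// => TE.
  have [Tc0 Tc1 Tc2] : [/\ fieldgen T c0, fieldgen T c1 & fieldgen T c2].
    by split; apply: fieldgen_in; right; rewrite /= /l 7!mem_cat !inE eqxx ?orbT.
  have -> : psi p q = - (- (c0 + c1 *+ p + c2 *+ q) * psi p q) / (c0 + c1 *+ p + c2 *+ q).
    by rewrite !mulNr opprK mulrAC divff ?mul1r.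
  apply: fieldgenM; first by apply/fieldgenN/TE; rewrite dE; lia.
  by apply: fieldgenV; apply: fieldgenD; first apply: fieldgenD => //; exact: fieldgenMn.
suff main e p q : (p + q <= e)%N -> (e <= N)%N -> fieldgen T (psi p q).
  by move=> i j ij; apply: (main N).
elim: e p q => [|e IHe] p q pq eN.
  apply: step => [|i j]; first by lia.
  by rewrite /monom_lt; lia.
elim/ltn_ind: p q pq => p IHp q pq; apply: step => [|i j ij]; first by lia.
have [ije|ije] := leqP (i + j) e; first by apply: IHe => //; lia.
by apply: IHp; move: ij; rewrite /monom_lt; lia.
Qed.
End Core.

(** * Neighborhoods without formal foliation *)

Section Neighborhoods.
Variable R : realType.
Implicit Types (S : set R[i]) (F G : fps2 R).

(** A square of side m of independent coefficients would lie in a field with O(m)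
generators.  The remaining terms of the initial segment of t that contains the
square are adjoined as generators, in order to count with whole segments. *)
Lemma generic_not_slowly_generated S G N0 (t : nat -> R[i]) :
    (forall n, transcendental_chain S (initial_segment t n)) ->
    (forall i j, (N0 < i + j)%N -> G i j = t (pickle (i, j))) ->
  ~ slowly_generated S G.
Proof.
(* With this m, r (N0 + 2m + 1) <= r (N0 + 3) m < m^2. *)
move=> chain Gt [r /= sG]; pose m := (r * (N0 + 3)).+1.
have [l [szl lG]] := sG (N0 + m + m)%N.
pose box := [seq pickle ((N0.+1 + i)%N, j) | i <- iota 0 m, j <- iota 0 m].
pose n := (\max_(k <- box) k).+1.
pose rest := [seq k <- iota 0 n | k \notin box].
have box_uniq : uniq box.
  apply: allpairs_uniq; rewrite ?iota_uniq// => -[i j] [i' j'] _ _ /=.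
  by move=> /(pcan_inj pickleK) [/eqP]; rewrite eqn_add2l => /eqP -> ->.
have box_n k : k \in box -> (k < n)%N.
  by move=> kbox; rewrite ltnS; apply: (@leq_bigmax_seq _ _ xpredT id).
have size_rest : (size rest + m * m = n)%N.
  have -> : (m * m = size [seq k <- iota 0 n | k \in box])%N.
    have -> : (m * m)%N = size box by rewrite size_allpairs !size_iota.
    apply: perm_size; apply: uniq_perm => //; first by rewrite filter_uniq ?iota_uniq.
    move=> k; rewrite mem_filter mem_iota /= add0n.
    by apply/idP/andP => [kbox|[]//]; split=> //; apply: box_n.
  by rewrite !size_filter addnC (count_predC (mem box)) size_iota.
have := @transcendental_chain_size _ S (initial_segment t n) (l ++ map t rest) (chain n).
have segment_size : size (initial_segment t n) = n by rewrite size_map size_rev size_iota.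
rewrite segment_size size_cat size_map => h.
have {h} : (n <= size l + size rest)%N.
  apply: h => _ /mapP[k + ->]; rewrite mem_rev => kn.
  have [kbox|kbox] := boolP (k \in box); last first.
    by apply: fieldgen_in; right; rewrite /= mem_cat map_f ?orbT// mem_filter kbox.
  have /allpairsP[[i j]] := kbox; rewrite !mem_iota /fst /snd => -[im jm ->].
  rewrite -Gt; last by lia.
  apply: fieldgenS (lG (N0.+1 + i)%N j _).
    by move=> x [Sx|xl]; [left | right; rewrite /= mem_cat; apply/orP; left].
  by move: im jm; lia.
have : (r * (N0 + m + m).+1 <= r * (N0 + 3) * m)%N.
  by rewrite -mulnA leq_mul2l /m; apply/orP; right; nia.
have : (r * (N0 + 3) * m < m * m)%N by rewrite ltn_mul2r /m ltnSn.
lia.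
Qed.

Lemma slowly_generated0 S : slowly_generated S (0 : fps2 R).
Proof. by exists 0%N => N; exists [::]; split=> //; apply: coefs_in0. Qed.

Lemma slowly_generated1 S : slowly_generated S (1 : fps2 R).
Proof. by exists 0%N => N; exists [::]; split=> //; apply: coefs_in1. Qed.

Lemma slowly_generated_x S : slowly_generated S (@fps2_x R).
Proof. by exists 0%N => N; exists [::]; split=> // i j _; apply: fieldgen_nat. Qed.

Lemma slowly_generated_y S : slowly_generated S (@fps2_y R).
Proof. by exists 0%N => N; exists [::]; split=> // i j _; apply: fieldgen_nat. Qed.

Lemma slowly_generated_coefs S F : (forall i j, S (F i j)) -> slowly_generated S F.
Proof.
move=> SF; exists 0%N => N; exists [::]; split=> // i j _.
by apply: fieldgen_in; left.
Qed.

Lemma slowly_generatedM S F G :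
  slowly_generated S F -> slowly_generated S G -> slowly_generated S (F * G).
Proof.
move=> [r sF] [s sG]; exists (r + s)%N => N.
have [l [szl lF]] := sF N; have [k [szk kG]] := sG N.
exists (l ++ k); split; first by rewrite size_cat mulnDl leq_add.
apply: coefs_inM => i j ij.
  apply: fieldgenS (lF i j ij) => x [Sx|xl]; [by left|].
  by right; rewrite /= mem_cat; apply/orP; left.
apply: fieldgenS (kG i j ij) => x [Sx|xl]; [by left|].
by right; rewrite /= mem_cat; apply/orP; right.
Qed.

Lemma polynomial_in_x_slowly_generated S F : polynomial_in_x F -> slowly_generated S F.
Proof.
move=> [n Fn]; exists n => N.
exists [seq F i j | i <- iota 0 n, j <- iota 0 N.+1].
split=> [|i j ij]; first by rewrite size_allpairs !size_iota.
have [ni|ni] := leqP n i; first by rewrite Fn//; apply: fieldgen0.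
by apply: fieldgen_in; right; apply: allpairs_f; rewrite mem_iota; lia.
Qed.

Lemma polynomial_in_y_slowly_generated S F : polynomial_in_y F -> slowly_generated S F.
Proof.
move=> [n Fn]; exists n => N.
exists [seq F i j | j <- iota 0 n, i <- iota 0 N.+1].
split=> [|i j ij]; first by rewrite size_allpairs !size_iota.
have [nj|nj] := leqP n j; first by rewrite Fn//; apply: fieldgen0.
apply: fieldgen_in; right; apply: (allpairs_f (fun j i => F i j));
  by rewrite mem_iota; lia.
Qed.

Lemma fps2_xM F i j : (@fps2_x R * F) i j = if i is k.+1 then F k j else 0.
Proof.
case: i => [|k]; rewrite fps2_coefM.
  by rewrite big_ord1 big1// => l _; rewrite /fps2_x mul0r.
rewrite big_ord_recl big1 ?add0r => [|l _]; last by rewrite /fps2_x mul0r.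
rewrite big_ord_recl big_ord_recl /fps2_x/= /bump/= subn1 subn0 mul1r.
rewrite big1 ?addr0 => [|l _]; last by rewrite mul0r.
by rewrite big1 ?addr0// => l _; rewrite big1// => l' _; rewrite mul0r.
Qed.

Lemma fps2_yM F i j : (@fps2_y R * F) i j = if j is k.+1 then F i k else 0.
Proof.
rewrite fps2_coefM big_ord_recl [X in _ + X]big1 ?addr0 => [|l _]; last first.
  by rewrite big1// => l' _; rewrite /fps2_y mul0r.
case: j => [|k]; first by rewrite big_ord1 /fps2_y mul0r.
rewrite big_ord_recl {1}/fps2_y mul0r add0r big_ord_recl /fps2_y/= /bump/= subn1 subn0 mul1r.
by rewrite big1 ?addr0// => l _; rewrite mul0r.
Qed.

Lemma fps2_x_dx F : @fps2_x R * fps2_dx F = euler_x F.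
Proof.
by apply/funext => i; apply/funext => j; rewrite fps2_xM; case: i.
Qed.

Lemma fps2_y_dy F : @fps2_y R * fps2_dy F = euler_y F.
Proof.
by apply/funext => i; apply/funext => j; rewrite fps2_yM; case: j.
Qed.

Lemma fps2_x_neq0 : @fps2_x R <> 0.
Proof.
by move=> /(congr1 (fun F : fps2 R => F 1 0)%N) /eqP; rewrite /fps2_x /= oner_eq0.
Qed.

Lemma fps2_y_neq0 : @fps2_y R <> 0.
Proof.
by move=> /(congr1 (fun F : fps2 R => F 0 1)%N) /eqP; rewrite /fps2_y /= oner_eq0.
Qed.

Lemma wedge_foliation_eq (phi psi : fps2 R) (w1 w2 : fps2 R * fps2 R) :
  foliation_eq w1.1 w1.2 (@fps2_x R * w2.1) (@fps2_y R * w2.2) phi psi =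
  @fps2_x R * @fps2_y R * wedge (pullback (phi, psi) w1) w2.
Proof.
rewrite /wedge /pullback /= !fps2_mulE /foliation_eq -!fps2_x_dx -!fps2_y_dy.
ring.
Qed.

(** For Q = 0 the factor P(phi, psi) cancels, and phi satisfies the equation of the
transfer principle for the form dy pulled back by (0, phi). *)
Lemma no_formal_foliation (phi psi : fps2 R) :
    ord_ge 1 0 phi -> phi 1%N 0%N = 1 -> ord_ge 0 1 psi -> psi 0%N 1%N = 1 ->
    ~ slowly_generated set0 phi -> ~ slowly_generated (range (fun ij => phi ij.1 ij.2)) psi ->
  ~ has_formal_foliation (phi, psi).
Proof.
move=> hphi phi1 hpsi psi1 nphi npsi [[P Q] [[P2 Q2] [[w1 w2] [/= sP sQ] [/= sP2 sQ2] E0]]].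
have hphi' : ord_ge 0 1 phi by apply: ord_geW hphi.
have XY : @fps2_x R * P2 <> 0 \/ @fps2_y R * Q2 <> 0.
  have [P20|P20] := pselect (P2 = 0); last first.
    by left; apply: fps2_mulf_neq0 => //; apply: fps2_x_neq0.
  have [Q20|Q20] := pselect (Q2 = 0); last first.
    by right; apply: fps2_mulf_neq0 => //; apply: fps2_y_neq0.
  by case: w2; rewrite P20 Q20.
have spX S : slowly_generated S (@fps2_x R * P2).
  apply: slowly_generatedM; first exact: slowly_generated_x.
  exact: polynomial_in_y_slowly_generated.
have spY S : slowly_generated S (@fps2_y R * Q2).
  apply: slowly_generatedM; first exact: slowly_generated_y.
  exact: polynomial_in_y_slowly_generated.
have [Q0|Q0] := pselect (Q = 0); last first.
  apply: npsi; apply: (slowly_generated_transfer (P := P) (Q := Q) hphi' hpsi _ _ XY) => //.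
  - by rewrite (wedge_foliation_eq phi psi (P, Q) (P2, Q2)) E0 mulr0.
  - exact: fps2_comp_neq0.
  - exact: polynomial_in_x_slowly_generated.
  - exact: polynomial_in_x_slowly_generated.
  - by apply: slowly_generated_coefs => i j; exists (i, j).
have P0 : P <> 0 by move=> P0; case: w1; rewrite P0 Q0.
have Pc := fps2_comp_neq0 hphi phi1 hpsi psi1 P0.
have comp0 : fps2_comp 0 (phi, psi) = 0.
  apply/funext => i; apply/funext => j; rewrite /fps2_comp big1// => k _.
  by rewrite big1// => l _; rewrite mul0r.
have dphi : fps2_dx phi * Q2 - fps2_dy phi * P2 = 0.
  apply: contrapT => nz; apply: (fps2_mulf_neq0 Pc nz).
  rewrite -[RHS]E0 /wedge /pullback /= !fps2_mulE Q0 comp0; ring.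
have h0 : ord_ge 0 1 (0 : fps2 R) by [].
apply: nphi; apply: (slowly_generated_transfer (P := 0) (Q := 1) h0 hphi' _ _ XY) => //.
- have [ex0 ey0] : euler_x (0 : fps2 R) = 0 /\ euler_y (0 : fps2 R) = 0.
    by split; apply/funext => i; apply/funext => j; rewrite /euler_x /euler_y mul0rn.
  rewrite /foliation_eq ex0 ey0 -fps2_x_dx -fps2_y_dy.
  move: (fps2_comp _ _) (fps2_comp _ _) => a b.
  transitivity (a * @fps2_x R * @fps2_y R * (fps2_dx phi * Q2 - fps2_dy phi * P2)).
    by ring.
  by rewrite dphi mulr0.
- move=> /(congr1 (fun F : fps2 R => F 0 0)%N) /eqP.
  rewrite /fps2_comp !big_ord1 /= fps2_mulE mulr1.
  by rewrite -[X in X * X]/(1 : R[i]) mulr1 oner_eq0.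
- exact: slowly_generated0.
- exact: slowly_generated1.
- exact: slowly_generated0.
Qed.

Lemma jet_leq (m n : nat) F G : (m <= n)%N -> jet n F = jet n G -> jet m F = jet m G.
Proof.
move=> mn FG; apply/funext => i; apply/funext => j; rewrite /jet.
case: ifP => // ijm; have := congr1 (fun H : fps2 R => H i j) FG.
by rewrite /jet (leq_trans ijm mn).
Qed.

End Neighborhoods.

Theorem theorem4p1 (R : realType) (Phi : fps2 R * fps2 R) (N0 : nat) (eps : R) :
  Diff1 Phi -> 0 < eps ->
  exists Phih : fps2 R * fps2 R,
    [/\ Diff1 Phih,
        jet_pair N0 Phi = jet_pair N0 Phih,
        (pair_norm (Phi - Phih)%R < eps%:E)%E &
        ~ has_formal_foliation Phih].
Proof.
case: Phi => phi0 psi0 [/= cphi0 cpsi0 [jphi0 jpsi0]] eps0.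
(* The 1-jet is kept too, so that the result is again tangent to the identity. *)
pose N := maxn N0 1.
have [phi [cphi jphi nphi [t [tchain phit]]]] :=
  generic_perturbation N (countable0 _) eps0 cphi0.
have cS : countable (range (fun ij : nat * nat => phi ij.1 ij.2)).
  exact: (sub_countable (card_image_le _ _) (countableP _)).
have [psi [cpsi jpsi npsi [u [uchain psiu]]]] :=
  generic_perturbation N cS eps0 cpsi0.
have N1 : (1 <= N)%N by rewrite leq_maxr.
have NN0 : (N0 <= N)%N by rewrite leq_maxl.
have phix : jet 1 phi = @fps2_x R by rewrite -jphi0 (jet_leq N1 jphi).
have psiy : jet 1 psi = @fps2_y R by rewrite -jpsi0 (jet_leq N1 jpsi).
have phiE i j : (i + j <= 1)%N -> phi i j = @fps2_x R i j.
  by move=> ij; rewrite -phix /jet ij.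
have psiE i j : (i + j <= 1)%N -> psi i j = @fps2_y R i j.
  by move=> ij; rewrite -psiy /jet ij.
exists (phi, psi); split.
- by split=> //=; rewrite /jet_pair /= phix psiy.
- by rewrite /jet_pair /= (jet_leq NN0 jphi) (jet_leq NN0 jpsi).
- by rewrite /pair_norm /= gt_max nphi npsi.
apply: no_formal_foliation.
- move=> i j ij; rewrite phiE; last by move: ij; rewrite /monom_lt; lia.
  by rewrite /fps2_x; move: ij; rewrite /monom_lt; case: i j => [|[|i]] [|j].
- by rewrite phiE.
- move=> i j ij; rewrite psiE; last by move: ij; rewrite /monom_lt; lia.
  by rewrite /fps2_y; move: ij; rewrite /monom_lt; case: i j => [|[|i]] [|[|j]].
- by rewrite psiE.
- exact: generic_not_slowly_generated tchain phit.
- exact: generic_not_slowly_generated uchain psiu.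
Qed.
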